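(* Consider the online energy harvesting two-hop status update system described in the context, with service times $d>0$ (source–relay) and $\bar d>0$ (relay–destination). Under the best effort uniform update policy with service constraints, the long term average age satisfies $$\limsup_{T\to\infty}\frac{1}{T}\mathbb{E}[A_T]=\max\left\{\tfrac12+d+\bar d,\ \tfrac32(d+\bar d)\right\},$$ and this value equals the optimal value $\rho$; that is, the best effort uniform update policy with service constraints is optimal.
   Context: A source sends status updates to a destination through a half-duplex relay. Energy arrives at the source and at the relay according to two independent Poisson processes of unit rate. Each node has an infinite battery, and at time $0$ each battery holds exactly one energy packet. Transmitting one update consumes one energy packet at the transmitting node, and a node may transmit only if its battery holds at least one packet just before the transmission time (energy causality). An update transmitted by the source at time $t_i$ is generated at time $t_i$ and reaches the relay at time $t_i+d$. The relay forwards it at a time $\bar t_i\ge t_i+d$ (data causality), and it reaches the destination at time $\bar t_i+\bar d$. The source may transmit the next update only at a time $t_{i+1}\ge \bar t_i+\bar d$. Transmission decisions are made online by a central controller which, at each time, knows the energy arrivals at both nodes up to that time but not future arrivals. The age of information is $a(t)=t-u(t)$, where $u(t)$ is the generation time of the latest update received at the destination before time $t$, with $a(0)=0$. Let $A_T=\int_0^T a(t)\,dt$, and let $\rho$ be the minimum, over all such feasible online policies, of $\limsup_{T\to\infty}\frac1T\mathbb{E}[A_T]$. Best effort uniform update policy with service constraints: define scheduled times $\ell_n=n\max\{1,d+\bar d\}$ for $n=0,1,2,\dots$. At each $\ell_n$, the following rule applies. - If just before $\ell_n$ the source and the relay each have at least one energy packet, the source transmits a new update at $\ell_n$ and the relay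 forwards it immediately upon reception, at time $\ell_n+d$. - Otherwise, both nodes stay silent until $\ell_{n+1}$. *)

(* Defs.v *)
From HB Require Import structures.
From mathcomp Require Import all_boot all_order all_algebra.
From mathcomp Require Import all_classical all_reals all_analysis.
From mathcomp Require Import measurable_realfun exponential_distribution.
Set Implicit Arguments. Unset Strict Implicit. Unset Printing Implicit Defensive.
Import Order.TTheory GRing.Theory Num.Theory.
Import numFieldNormedType.Exports.
Local Open Scope classical_set_scope.
Local Open Scope ring_scope.

Section System.
Context {R : realType} {d0 : measure_display} {Omega : measurableType d0}.

(* X k : k-th interarrival time of energy at the source; Y k : at the relay.
   The harvested packet number k (k >= 1) arrives at  X 0 + ... + X (k-1).
   [arrival X k w] is the arrival time of harvested packet number k.+1. *)
Definition arrival (X : nat -> Omega -> R) (k : nat) (w : Omega) : R :=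
  \sum_(j < k.+1) X j w.

(* Energy arrival processes: X and Y are all mutually independent, each
   Exp(1)-distributed (so that arrivals are two independent unit rate
   Poisson processes): the joint law of (X 0,Y 0,...,X (n-1),Y (n-1)) is
   the product of exponential laws. *)
Definition poisson_energy_arrivals (P : probability Omega R)
    (X Y : nat -> Omega -> R) : Prop :=
  (forall k, measurable_fun setT (X k)) /\
  (forall k, measurable_fun setT (Y k)) /\
  forall (n : nat) (B C : nat -> set R),
    (forall k, measurable (B k)) -> (forall k, measurable (C k)) ->
    P (\bigcap_(k in [set j | (j < n)%N]) (X k @^-1` B k `&` Y k @^-1` C k))
    = (\prod_(k < n) (exponential_prob (1:R) (B k) * exponential_prob (1:R) (C k)))%E.

(* Just before time x, a node whose arrivals are given by X has made i
   transmissions so far and holds at least one packet: its initial packet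
   (i = 0) or the i-th harvested packet arrived strictly before x. *)
Definition has_energy (X : nat -> Omega -> R) (i : nat) (x : R) (w : Omega) : bool :=
  (i == 0)%N || (arrival X i.-1 w < x).

Definition same_history (X Y : nat -> Omega -> R) (x : R) (w w' : Omega) : Prop :=
  (forall k, (arrival X k w <= x \/ arrival X k w' <= x) ->
     arrival X k w = arrival X k w') /\
  (forall k, (arrival Y k w <= x \/ arrival Y k w' <= x) ->
     arrival Y k w = arrival Y k w').

(* A policy: t i w = time the source transmits update i (i = 0,1,...),
   tb i w = time the relay forwards it; +oo means "never". *)
Definition feasible_online_policy (d db : R) (X Y : nat -> Omega -> R)
    (t tb : nat -> Omega -> \bar R) : Prop :=
  (forall i, measurable_fun setT (t i : Omega -> \bar R)) /\
  (forall i, measurable_fun setT (tb i : Omega -> \bar R)) /\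
  (forall w, (0 <= t 0%N w)%E) /\
  (forall i w, (t i w + d%:E <= tb i w)%E) /\
  (forall i w, (tb i w + db%:E <= t i.+1 w)%E) /\
  (forall i w x, t i w = x%:E -> has_energy X i x w) /\
  (forall i w x, tb i w = x%:E -> has_energy Y i x w) /\
  (forall x w w', same_history X Y x w w' -> forall i,
     ((t i w <= x%:E)%E -> t i w' = t i w) /\
     ((tb i w <= x%:E)%E -> tb i w' = tb i w)).

(* generation time of the latest update received at the destination before
   time x (0 if none), and the age of information *)
Definition latest_gen (db : R) (t tb : nat -> Omega -> \bar R) (x : R) (w : Omega)
  : \bar R :=
  ereal_sup ([set 0%E] `|` [set t i w | i in [set i | (tb i w + db%:E < x%:E)%E]]).

Definition age db t tb (x : R) w : \bar R := (x%:E - latest_gen db t tb x w)%E.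

Definition area db t tb (T : R) w : \bar R :=
  (\int[lebesgue_measure]_(x in `[0%R, T]) age db t tb x w)%E.

Definition avg_age (P : probability Omega R) db t tb : \bar R :=
  limf_esup (fun T : R => ((T^-1)%:E * \int[P]_w area db t tb T w)%E)
            (pinfty_nbhs R).

Definition rho (P : probability Omega R) d db X Y : \bar R :=
  ereal_inf [set e : \bar R | exists (t tb : nat -> Omega -> \bar R),
                   feasible_online_policy d db X Y t tb /\ e = avg_age P db t tb].

Definition beu_period (d db : R) : R := Num.max 1 (d + db).

(* number of updates sent at slots 0..n-1, and whether slot n transmits *)
Fixpoint beu_count d db X Y (n : nat) (w : Omega) : nat :=
  match n with
  | 0%N => 0%N
  | m.+1 => (beu_count d db X Y m w +
      (has_energy X (beu_count d db X Y m w) (m%:R * beu_period d db) w &&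
       has_energy Y (beu_count d db X Y m w) (m%:R * beu_period d db) w))%N
  end.

Definition beu_tx d db X Y (n : nat) (w : Omega) : bool :=
  has_energy X (beu_count d db X Y n w) (n%:R * beu_period d db) w &&
  has_energy Y (beu_count d db X Y n w) (n%:R * beu_period d db) w.

Definition beu_t d db X Y (i : nat) (w : Omega) : \bar R :=
  ereal_inf [set (n%:R * beu_period d db)%:E | n in
     [set n | beu_tx d db X Y n w && (beu_count d db X Y n w == i)]].

Definition beu_tb d db X Y (i : nat) (w : Omega) : \bar R :=
  (beu_t d db X Y i w + d%:E)%E.

End System.

(* Main.v *)
(* Write s = d + db for the total service time and p = max(1, s) for the slot
   length; the claimed value is s + p/2.

   Lower bound.  Along any feasible trajectory whose K-th transmission is not
   before T, integrating the tangent line y^2/2 >= p y - p^2/2 over the gaps y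
   between transmissions bounds the area on [0, T] below by
   (s + p) T - K p^2/2 - O(1).  One may take K ~ T/p: if s >= 1 since successive
   transmissions are at least s apart, and if s < 1 since transmission K
   (counted from 0) needs K harvests at the source, which by Chebyshev's inequality
   are complete before T only with probability O(1/T).

   Upper bound.  If every slot were used, the best effort policy would have average
   age exactly s + p/2, so only the idle slots matter.  Their number up to slot n is
   at most 1 + max_c (S_c - c), where S_c is the c-th arrival time at one of the two
   nodes, and this has expectation o(n) by a second moment bound on a coarse grid.
   A run of idle slots is no longer than the interarrival time of the packet
   it waits for, so third moments of the exponential law show that the idle slots
   contribute o(n) to the area. *)
Require Import Defs.
From HB Require Import structures.
From mathcomp Require Import all_boot all_order all_algebra.
From mathcomp Require Import all_classical all_reals all_analysis.
From mathcomp Require Import measurable_realfun exponential_distribution.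
From mathcomp Require Import ring lra zify.
Set Implicit Arguments. Unset Strict Implicit. Unset Printing Implicit Defensive.
Import Order.TTheory GRing.Theory Num.Theory.
Import numFieldNormedType.Exports.
Local Open Scope classical_set_scope.
Local Open Scope ring_scope.

(** * Integration *)

(* Neither side need be measurable: this spares proving that the age and the area
   are measurable. *)
Lemma le_integral_pointwise d (T : measurableType d) (R : realType)
    (mu : {measure set T -> \bar R}) (D : set T) (f g : T -> \bar R) :
  (forall x, D x -> (f x <= g x)%E) ->
  (\int[mu]_(x in D) f x <= \int[mu]_(x in D) g x)%E.
Proof.
have mono (h k : T -> \bar R) : (forall x, 0 <= h x)%E ->
    (forall x, h x <= k x)%E -> (\int[mu]_x h x <= \int[mu]_x k x)%E.
  move=> h0 hk; have k0 x : (0 <= k x)%E by exact: le_trans (hk x).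
  rewrite !ge0_integralTE//; apply: ereal_sup_le => _ [s sh <-].
  by exists s => // x; exact: le_trans (hk x).
move=> fg; rewrite (integral_mkcond D f) (integral_mkcond D g).
have {}fg x : ((f \_ D) x <= (g \_ D) x)%E.
  by rewrite !patchE; case: ifPn => // /[!inE]; exact: fg.
rewrite integralE [leRHS]integralE leeB//; apply: mono => x //.
  by apply: (@funepos_le _ _ setT); rewrite ?inE// => y _; exact: fg.
by apply: (@funeneg_le _ _ setT); rewrite ?inE// => y _; exact: fg.
Qed.

(** The Radon-Nikodym derivative of [nu] and [g] have the same integral over every measurable set,
    hence agree almost everywhere, so the change of variables for the former passes to [g]. *)
Lemma ge0_integral_density (R : realType) (nu : {finite_measure set (measurableTypeR R) -> \bar R})
    (g : R -> R) (f : R -> \bar R) :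
  (forall x, 0 <= g x) -> lebesgue_measure.-integrable setT (EFin \o g) ->
  (forall A, measurable A -> nu A = \int[lebesgue_measure]_(x in A) (g x)%:E)%E ->
  measurable_fun setT f -> (forall x, 0 <= f x)%E ->
  (\int[nu]_x f x = \int[lebesgue_measure]_x (f x * (g x)%:E))%E.
Proof.
move=> g0 ig nug mf f0.
have dom : nu `<< lebesgue_measure.
  apply/null_content_dominatesP => A mA A0; rewrite nug//.
  by apply: null_set_integral => //; apply: measurable_funTS; exact: measurable_int ig.
rewrite -(Radon_Nikodym_SigmaFinite.change_of_variables dom)//.
have mr := measurable_int _ (Radon_Nikodym_SigmaFinite.f_integrable dom).
apply: ae_eq_integral => //.
- exact: emeasurable_funM.
- by apply: emeasurable_funM => //; exact: measurable_int ig.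
apply: ae_eqe_mul2l; apply: integral_ae_eq => //.
- exact: Radon_Nikodym_SigmaFinite.f_integrable.
- exact: measurable_int ig.
- by move=> E _ mE; rewrite -Radon_Nikodym_SigmaFinite.f_integral// nug.
Qed.

Lemma ge0_integral_exponential_mean (R : realType) :
  (\int[lebesgue_measure]_x (`|x|%:E * (exponential_pdf (1 : R) x)%:E) = 1)%E.
Proof.
have mf : measurable_fun setT (fun x : R => (`|x|%:E * (exponential_pdf (1 : R) x)%:E)%E).
  apply: emeasurable_funM; apply/measurable_EFinP; first exact: normr_measurable.
  exact: measurable_exponential_pdf.
rewrite -(setUv `[0, +oo[%classic) ge0_integral_setU//=; last 4 first.
- exact: measurableC.
- by rewrite setUv.
- by move=> x _; rewrite mule_ge0// lee_fin exponential_pdf_ge0.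
- exact/disj_setPCl.
rewrite [X in (_ + X)%E]integral0_eq ?adde0; last first.
  by move=> x x0; rewrite /exponential_pdf patchE ifF ?mule0// memNset.
transitivity (\int[lebesgue_measure]_(x in `[0%R, +oo[) ((x : R) * expR (- x))%:E)%E.
  apply: eq_integral => x; rewrite inE/= in_itv/= andbT => x0.
  by rewrite exponential_pdfE// ger0_norm// mul1r mulN1r -EFinM.
have cexp : continuous (fun z : R^o => expR (- z)).
  move=> z; apply: continuous_comp; last exact: continuous_expR.
  by apply: cvgN; exact: cvg_id.
have cF : continuous (fun x : R => - ((x + 1) * expR (- x))).
  move=> z; apply: cvgN; apply: cvgM; last exact: cexp.
  by apply: cvgD; [exact: cvg_id|exact: cvg_cst].
set f := fun x : R => x * expR (- x).
set F := fun x : R => - ((x + 1) * expR (- x)).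
transitivity (0%:E - (F 0)%:E)%E; last first.
  by rewrite -EFinB /F oppr0 expR0 mulr1 opprK !add0r.
apply: (@ge0_continuous_FTC2y R f F 0 0).
- by move=> x x0; rewrite mulr_ge0 ?expR_ge0.
- by apply: continuous_subspaceT => z; apply: cvgM; [exact: cvg_id|exact: cexp].
(* The antiderivative vanishes at infinity: [1 + x / 2 <= expR (x / 2)] gives [(x + 1) * expR (- x)
   <= 2 * expR (- (x / 2))]. *)
- rewrite -oppr0; apply: cvgN.
  apply: (@squeeze_cvgr _ _ _ _ (fun=> 0) (fun x => 2 * expR (- (x / 2)))).
  + near=> x; have x0 : 0 <= x by near: x; exact: nbhs_pinfty_ge.
    rewrite mulr_ge0 ?expR_ge0 ?addr_ge0//=.
    have := expR_ge1Dx (x / 2) => h.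
    have -> : expR (- x) = expR (- (x / 2)) * expR (- (x / 2)).
      by rewrite -expRD; congr expR; lra.
    rewrite mulrA ler_wpM2r ?expR_ge0//.
    have := expRxMexpNx_1 (x / 2); have := expR_ge0 (- (x / 2)); nra.
  + exact: cvg_cst.
  + rewrite -(mulr0 2); apply: cvgMr.
    apply: (@cvg_comp _ _ _ (fun x => x / 2) (fun z => expR (- z)) _ (pinfty_nbhs R)).
      by apply: gt0_cvgMly.
    exact: cvgr_expR.
- by move=> x _; exact: ex_derive.
- by apply/cvg_at_right_filter; exact: cF.
- move=> z _; rewrite derive1E.
  rewrite derive_val.
  by rewrite /f /GRing.scale /=; ring.
Unshelve. all: by end_near. Qed.

(** The exact value is 6, but any finite bound serves; 96 is 48 divided by the rate 1/2. *)
Lemma integral_exponential_cube_le (R : realType) :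
  (\int[lebesgue_measure]_x ((`|x| ^+ 3)%:E * (exponential_pdf (1 : R) x)%:E) <= 96%:E)%E.
Proof.
have h0 : (0 : R) < 2^-1 by rewrite invr_gt0.
(* x^3 <= 48 e^(x/2), which turns the integrand into the rate 1/2 density. *)
suff key (x : R) : `|x| ^+ 3 * exponential_pdf 1 x <= 96 * exponential_pdf 2^-1 x.
  have -> : 96%:E = (96%:E * \int[lebesgue_measure]_x (exponential_pdf (2^-1 : R) x)%:E)%E.
    by rewrite integral_exponential_pdf// mule1.
  rewrite -ge0_integralZl//; last 2 first.
  - by apply/measurable_EFinP; exact: measurable_exponential_pdf.
  - by move=> x _; rewrite lee_fin exponential_pdf_ge0// ltW.
  by apply: le_integral_pointwise => x _; rewrite -!EFinM lee_fin; exact: key.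
have [x0|x0] := ltP x 0; first by rewrite !lt0_exponential_pdf// !mulr0.
rewrite !exponential_pdfE// ger0_norm// mul1r mulN1r.
have -> : expR (- x) = expR (- 2^-1 * x) * expR (- 2^-1 * x).
  by rewrite -expRD; congr expR; lra.
rewrite !mulrA ler_wpM2r ?expR_ge0//.
have hu : 1 + (x / 2) ^+ 3 / 6 <= expR (x / 2) by apply: (expR_ge1Dxn 2); rewrite divr_ge0.
have ue : expR (x / 2) * expR (- 2^-1 * x) = 1.
  have -> : - 2^-1 * x = - (x / 2) by lra.
  exact: expRxMexpNx_1.
have e0 := expR_ge0 (- 2^-1 * x).
have {}hu : x ^+ 3 <= 48 * expR (x / 2) by move: hu; rewrite exprMn !exprS expr0; lra.
by have := ler_wpM2r e0 hu; rewrite -[X in _ <= X]mulrA ue; lra.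
Qed.

Lemma integral_affine (R : realType) (u v a b : R) : a <= b ->
  (\int[lebesgue_measure]_(x in `[a, b]) (u * x + v)%:E =
   (u * (b ^+ 2 - a ^+ 2) / 2 + v * (b - a))%:E)%E.
Proof.
rewrite le_eqVlt => /predU1P[->|ab].
  by rewrite set_itv1 integral_set1 !subrr !mulr0 mul0r addr0.
set f := fun x : R => u * x + v.
set F := fun x : R => u / 2 * x ^+ 2 + v * x.
have cf : continuous f.
  move=> z; apply: cvgD; last exact: cvg_cst.
  by apply: cvgM; [exact: cvg_cst|exact: cvg_id].
have cF : continuous F.
  move=> z; apply: cvgD; apply: cvgM; [exact: cvg_cst| |exact: cvg_cst|exact: cvg_id].
  by rewrite /F expr2; under eq_fun do rewrite expr2; apply: cvgM; exact: cvg_id.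
transitivity ((F b)%:E - (F a)%:E)%E; last first.
  by rewrite -EFinB /F; congr (_%:E); lra.
apply: (@continuous_FTC2 R f F a b) => //.
- exact: continuous_subspaceT.
- split.
  + by move=> x _; exact: ex_derive.
  + by apply/cvg_at_right_filter; exact: cF.
  + by apply/cvg_at_left_filter; exact: cF.
- move=> z _; rewrite derive1E derive_val /f /GRing.scale /= ?expr1; lra.
Qed.

(** * Sums of nonnegative functions supported on pieces *)

Section Pieces.
Context d (T : measurableType d) (R : realType) (mu : {measure set T -> \bar R}).
Variables (J : nat -> set T) (f : nat -> T -> R) (r : nat -> R).
Hypothesis mJ : forall i, measurable (J i).
Hypothesis mf : forall i, measurable_fun setT (f i).
Hypothesis f0 : forall i x, J i x -> 0 <= f i x.
Hypothesis fr : forall i, (\int[mu]_(x in J i) (f i x)%:E <= (r i)%:E)%E.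

(** The pieces may overlap: since they are nonnegative, their sum dominates each of them. It serves
    as a measurable envelope for the age or for its deficit. *)
Definition sum_pieces n x := \sum_(i < n) (f i \_ (J i)) x.

Let piece_ge0 i x : 0 <= (f i \_ (J i)) x.
Proof. by rewrite patchE; case: ifPn => // /[!inE]; exact: f0. Qed.

Lemma sum_pieces_ge0 n x : 0 <= sum_pieces n x.
Proof. exact: sumr_ge0. Qed.

Lemma le_sum_pieces n i x : (i < n)%N -> J i x -> f i x <= sum_pieces n x.
Proof.
move=> ni Jx; rewrite /sum_pieces (bigD1 (Ordinal ni))//= patchE mem_set//.
by rewrite lerDl sumr_ge0.
Qed.

Let mpiece i : measurable_fun setT (f i \_ (J i)).
Proof. by apply/(measurable_restrictT _ _).1 => //; exact: measurable_funTS. Qed.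

Lemma measurable_sum_pieces n : measurable_fun setT (sum_pieces n).
Proof. by apply: measurable_sum => i; exact: mpiece. Qed.

Lemma integral_sum_pieces_le n D :
  (\int[mu]_(x in D) (sum_pieces n x)%:E <= (\sum_(i < n) r i)%:E)%E.
Proof.
apply: (@le_trans _ _ (\int[mu]_x (sum_pieces n x)%:E)%E).
  rewrite integral_mkcond; apply: le_integral_pointwise => x _.
  by rewrite patchE; case: ifP => // _; rewrite lee_fin sum_pieces_ge0.
under eq_integral do rewrite -sumEFin.
rewrite ge0_integral_sum//; last 2 first.
- by move=> i; apply/measurable_EFinP; exact: mpiece.
- by move=> i x _; rewrite lee_fin piece_ge0.
rewrite -sumEFin; apply: lee_sum => i _.
apply: le_trans (fr i); rewrite [leRHS]integral_mkcond.
by apply: le_integral_pointwise => x _; rewrite !patchE; case: ifP.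
Qed.

End Pieces.

(** The integrand may change sign, so the integral is split by integrability of [H], which the
    finite bound [r] provides. It is used for Lebesgue measure on [[0, T]] and for [P]. *)
Lemma integral_cst_sub_ge d (T : measurableType d) (R : realType)
    (mu : {measure set T -> \bar R}) (D : set T) (H : T -> R) (a m r : R) :
  measurable D -> mu D = m%:E -> measurable_fun D H -> (forall x, 0 <= H x) ->
  (\int[mu]_(x in D) (H x)%:E <= r%:E)%E ->
  ((a * m - r)%:E <= \int[mu]_(x in D) (a - H x)%:E)%E.
Proof.
move=> mD Dm mH H0 Hr.
have iH : mu.-integrable D (EFin \o H).
  apply/integrableP; split; first exact/measurable_EFinP.
  under eq_integral do rewrite /= ger0_norm//.
  exact: le_lt_trans Hr (ltry _).
have ia : mu.-integrable D (EFin \o cst a).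
  apply/integrableP; split; first exact/measurable_EFinP.
  by rewrite /= integral_cst// Dm -EFinM ltry.
under eq_integral do rewrite EFinB.
rewrite (integralB mD ia iH) /= integral_cst// Dm -EFinM EFinB.
exact: leeB.
Qed.

(** * Limits superior as T tends to infinity *)

Section Limsup.
Context {R : realType}.
Implicit Types (f : R -> \bar R) (v : R).

Lemma limf_esup_le_eventually f v :
  (forall e, 0 < e -> exists T0 : R, forall T, T0 <= T -> (f T <= (v + e)%:E)%E) ->
  (limf_esup f (pinfty_nbhs R) <= v%:E)%E.
Proof.
move=> h; apply/lee_addgt0Pr => e e0; have [T0 hT] := h _ e0.
rewrite -EFinD /limf_esup; apply: ge_ereal_inf.
exists (ereal_sup (f @` [set T | T0 < T])).
  by exists [set T | T0 < T] => //; exists T0; split => //; rewrite num_real.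
by apply: ge_ereal_sup => _ [T /= /ltW T0T <-]; exact: hT.
Qed.

Lemma limf_esup_ge_eventually f v :
  (forall e, 0 < e -> exists T0 : R, forall T, T0 <= T -> ((v - e)%:E <= f T)%E) ->
  (v%:E <= limf_esup f (pinfty_nbhs R))%E.
Proof.
move=> h; apply/lee_subgt0Pr => e e0; have [T0 hT] := h _ e0.
rewrite -EFinB /limf_esup; apply: le_ereal_inf_tmp => _ [A [M [_ MA]] <-].
pose T := Num.max T0 (M + 1).
apply: (@le_trans _ _ (f T)); first by apply: hT; rewrite le_max lexx.
apply: ereal_sup_ubound; exists T => //; apply: MA.
by rewrite /T lt_max ltrDl ltr01 orbT.
Qed.

End Limsup.

(** * Exponential interarrival times *)

Section PairwiseExponential.
Context {R : realType} {d0 : measure_display} {Omega : measurableType d0}.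
Implicit Types (P : probability Omega R) (X Y U : nat -> Omega -> R).

(** One- and two-dimensional laws of one node's interarrival times; they determine every moment used
    below. *)
Definition pairwise_exponential P X : Prop :=
  [/\ forall k, measurable_fun setT (X k),
      forall k B, measurable B -> P (X k @^-1` B) = exponential_prob 1 B
    & forall i j B C, (i != j)%N -> measurable B -> measurable C ->
      P (X i @^-1` B `&` X j @^-1` C) =
      (exponential_prob 1 B * exponential_prob 1 C)%E].

Lemma poisson_energy_arrivalsC P X Y :
  poisson_energy_arrivals P X Y -> poisson_energy_arrivals P Y X.
Proof.
move=> [mX [mY pXY]]; split=> //; split=> // n B C mB mC.
under eq_bigr do rewrite muleC.
by rewrite -(pXY n C B)//; congr (P _); apply: eq_bigcapr => k _; rewrite setIC.
Qed.

Lemma poisson_pairwise_exponential P X Y :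
  poisson_energy_arrivals P X Y -> pairwise_exponential P X.
Proof.
move=> [mX [mY pXY]].
have eT : exponential_prob (1 : R) setT = 1%E by rewrite /exponential_prob integral_exponential_pdf.
have pair i j B C : (i != j)%N -> measurable B -> measurable C ->
    P (X i @^-1` B `&` X j @^-1` C) =
    (exponential_prob 1 B * exponential_prob 1 C)%E.
  move=> ij mB mC.
  (* With the whole line at every other index, the product law collapses to the factors at [i] and
     [j]. *)
  pose D k := if (k == i)%N then B else if (k == j)%N then C else setT.
  have mD k : measurable (D k) by rewrite /D; case: ifP => // _; case: ifP.
  have Di : D i = B by rewrite /D eqxx.
  have Dj : D j = C by rewrite /D eq_sym (negbTE ij) eqxx.
  pose n := (maxn i j).+1.
  have ni : (i < n)%N by rewrite ltnS leq_maxl.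
  have nj : (j < n)%N by rewrite ltnS leq_maxr.
  have := pXY n D (fun=> setT) mD (fun=> measurableT).
  under eq_bigr do rewrite eT mule1.
  rewrite (bigD1 (Ordinal ni))//= (bigD1 (Ordinal nj))//=; last first.
    by rewrite -val_eqE/= eq_sym.
  rewrite big1 ?mule1 => [|k]; last first.
    by rewrite -!val_eqE/= /D => /andP[/negbTE -> /negbTE ->].
  rewrite Di Dj => <-; congr (P _); apply/seteqP; split => w /=.
    move=> [wB wC] k _; split=> //=; rewrite /D.
    by case: eqP => [->//|_]; case: eqP => [->|].
  by move=> h; split; [case: (h i ni); rewrite /= Di|case: (h j nj); rewrite /= Dj].
split=> // k B mB.
have := pair k k.+1 B setT; rewrite preimage_setT setIT eT mule1; apply=> //.
by rewrite neq_ltn ltnSn.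
Qed.

Lemma ge0_integral_exponential P X k (f : R -> R) :
  pairwise_exponential P X -> measurable_fun setT f -> (forall x, 0 <= f x) ->
  (\int[P]_w (f (X k w))%:E =
   \int[lebesgue_measure]_x ((f x)%:E * (exponential_pdf (1 : R) x)%:E))%E.
Proof.
move=> [mX pX _] mf f0.
have mXk : measurable_fun setT (X k : Omega -> measurableTypeR R) by exact: mX.
pose Xk : {mfun Omega >-> measurableTypeR R} := HB.pack (X k : Omega -> measurableTypeR R)
  (isMeasurableFun.Build _ _ _ _ _ mXk).
rewrite -(@ge0_integral_density _ (distribution P Xk) _ (EFin \o f)).
- rewrite (@ge0_integral_distribution _ _ _ _ _ P Xk)//.
  exact/measurable_EFinP.
- by move=> x; exact: exponential_pdf_ge0.
- exact: integrable_exponential_pdf.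
- by move=> A mA; exact: pX.
- exact/measurable_EFinP.
- by move=> x; rewrite lee_fin.
Qed.

Lemma expectation_abs P X k : pairwise_exponential P X ->
  (\int[P]_w `|X k w|%:E = 1)%E.
Proof.
move=> hX; rewrite (ge0_integral_exponential k hX (f := fun x => `|x|))//.
exact: ge0_integral_exponential_mean.
Qed.

Lemma expectation_abs_cube_le P X k : pairwise_exponential P X ->
  (\int[P]_w (`|X k w| ^+ 3)%:E <= 96%:E)%E.
Proof.
move=> hX; rewrite (ge0_integral_exponential k hX (f := fun x => `|x| ^+ 3))//.
  exact: integral_exponential_cube_le.
by apply: measurable_funX; exact: normr_measurable.
Qed.

(** Interarrival times are nonnegative only almost surely. The lower bound discards this null event
    when it identifies harvest times with sums of absolute values. *)
Lemma exponential_lt0_null P X k : pairwise_exponential P X ->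
  P [set w | X k w < 0] = 0%E.
Proof.
move=> [_ pX _]; have -> : [set w | X k w < 0] = X k @^-1` `]-oo, 0[.
  by apply/seteqP; split => w /=; rewrite in_itv.
rewrite pX// /exponential_prob integral0_eq// => x /=; rewrite in_itv/= => x0.
by rewrite lt0_exponential_pdf.
Qed.

(** Pairwise independence on rectangles identifies the joint law with the product of the marginals;
    Tonelli then factors the integral into two means equal to 1. *)
Lemma expectation_abs_mul P X i j : (i != j)%N -> pairwise_exponential P X ->
  (\int[P]_w (`|X i w| * `|X j w|)%:E = 1)%E.
Proof.
move=> ij hX; have [mX pX pXX] := hX.
pose Xi : {mfun Omega >-> R} := HB.pack (X i) (isMeasurableFun.Build _ _ _ _ _ (mX i)).
pose Xj : {mfun Omega >-> R} := HB.pack (X j) (isMeasurableFun.Build _ _ _ _ _ (mX j)).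
have mXX : measurable_fun setT (fun w => (X i w, X j w)) by exact: measurable_fun_pair.
pose XX : {mfun Omega >-> (R * R)%type} := HB.pack (fun w => (X i w, X j w))
  (isMeasurableFun.Build _ _ _ _ _ mXX).
pose f (z : R * R) := (`|z.1| * `|z.2|)%:E.
have mf : measurable_fun setT f.
  apply/measurable_EFinP; apply: measurable_funM.
    by apply: (measurableT_comp (@normr_measurable R setT)); exact: measurable_fst.
  by apply: (measurableT_comp (@normr_measurable R setT)); exact: measurable_snd.
have f0 z : (0 <= f z)%E by rewrite lee_fin mulr_ge0.
transitivity (\int[distribution P XX]_z f z)%E.
  by rewrite (@ge0_integral_distribution _ _ _ _ _ P XX).
transitivity (\int[distribution P Xi \x distribution P Xj]_z f z)%E.
  apply: eq_measure_integral => A mA _; apply/esym.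
  apply: product_measure_unique => // B C mB mC.
  by rewrite /= /pushforward -[LHS]/(P (X i @^-1` B `&` X j @^-1` C)) (pXX i j)//
     -(pX i)// -(pX j)//.
rewrite fubini_tonelli1// /fubini_F.
under eq_integral => x _.
  under eq_integral do rewrite /f /= EFinM.
  rewrite ge0_integralZl//; last 1 first.
    by apply/measurable_EFinP; exact: normr_measurable.
  rewrite (@ge0_integral_distribution _ _ _ _ _ P Xj (fun y => `|y|%:E))//; last first.
    by apply/measurable_EFinP; exact: normr_measurable.
  rewrite /= expectation_abs// mule1.
  over.
rewrite (@ge0_integral_distribution _ _ _ _ _ P Xi (fun y => `|y|%:E))//; last first.
  by apply/measurable_EFinP; exact: normr_measurable.
exact: expectation_abs.
Qed.

End PairwiseExponential.

(** * Variance of the arrival times *)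

Section SecondMoment.
Context {R : realType} {d0 : measure_display} {Omega : measurableType d0}.
Implicit Types (P : probability Omega R) (X : nat -> Omega -> R).

(** Almost surely the arrival time of the [n]-th harvested packet (0 for [n = 0]); the absolute
    values make it nonnegative and monotone in [n] at every [w]. *)
Definition abs_arrival X (n : nat) (w : Omega) : R := \sum_(j < n) `|X j w|.

Lemma measurable_abs_arrival X n : (forall k, measurable_fun setT (X k)) ->
  measurable_fun setT (abs_arrival X n).
Proof.
move=> mX; apply: measurable_sum => j.
exact: measurableT_comp (@normr_measurable R setT) (mX j).
Qed.

(** From [z ^+ 2 <= 1 + z ^+ 3] for [z >= 0], and 97 = 1 + 96. *)
Lemma expectation_abs_sqr_le P X i : pairwise_exponential P X ->
  (\int[P]_w (`|X i w| * `|X i w|)%:E <= 97%:E)%E.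
Proof.
move=> hX; have [mX _ _] := hX.
have mA : measurable_fun setT (fun w => `|X i w|).
  exact: measurableT_comp (@normr_measurable R setT) (mX i).
apply: (@le_trans _ _ (\int[P]_w (1%:E + (`|X i w| ^+ 3)%:E))%E).
  apply: le_integral_pointwise => w _; rewrite -EFinD lee_fin.
  have := normr_ge0 (X i w); set z := `|_| => z0.
  rewrite !exprS expr0; have [z1|/ltW z1] := leP z 1; first by nra.
  have : z * z <= z * (z * z) by rewrite ler_peMl// mulr_ge0.
  by rewrite mulr1; lra.
rewrite ge0_integralD//; last first.
  by apply/measurable_EFinP; exact: measurable_funX.
rewrite integral_cst//= probability_setT mul1e.
have -> : (97%:E = 1%:E + 96%:E :> \bar R)%E by rewrite -EFinD; congr (_%:E); lra.
by rewrite leeD2l// expectation_abs_cube_le.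
Qed.

(** The mean is [n]. In the second moment the diagonal terms cost at most 97 each and the
    off-diagonal ones are 1, which gives at most [n * (n + 96)]. *)
Lemma abs_arrival_variance_le P X n : pairwise_exponential P X ->
  (\int[P]_w ((abs_arrival X n w - n%:R) ^+ 2)%:E <= (97 * n%:R)%:E)%E.
Proof.
move=> hX; have [mX _ _] := hX.
have mA i : measurable_fun setT (fun w => `|X i w|).
  exact: measurableT_comp (@normr_measurable R setT) (mX i).
have mS := measurable_abs_arrival n mX.
have S0 w : 0 <= abs_arrival X n w by exact: sumr_ge0.
have mean : (\int[P]_w (abs_arrival X n w)%:E = n%:R%:E)%E.
  under eq_integral do rewrite -sumEFin.
  rewrite ge0_integral_sum//; last first.
    by move=> i; apply/measurable_EFinP.
  under eq_bigr do rewrite (expectation_abs _ hX).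
  by rewrite sumEFin sumr_const card_ord.
have sqr : (\int[P]_w (abs_arrival X n w ^+ 2)%:E <= (n%:R * (n%:R + 96))%:E)%E.
  have E w : (abs_arrival X n w ^+ 2)%:E =
      (\sum_(i < n) \sum_(j < n) (`|X i w| * `|X j w|)%:E)%E.
    rewrite expr2 {1}/abs_arrival mulr_suml -sumEFin; apply: eq_bigr => i _.
    by rewrite mulr_sumr sumEFin.
  under eq_integral do rewrite E.
  rewrite ge0_integral_sum//; last 2 first.
  - move=> i; apply: emeasurable_sum => j; apply/measurable_EFinP.
    exact: measurable_funM.
  - by move=> i w _; apply: sume_ge0 => j _; rewrite lee_fin mulr_ge0.
  have row (i : 'I_n) :
      (\int[P]_w (\sum_(j < n) (`|X i w| * `|X j w|)%:E) <= (n%:R + 96)%:E)%E.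
    rewrite ge0_integral_sum//; last first.
      by move=> j; apply/measurable_EFinP; exact: measurable_funM.
    rewrite (bigD1 i)//=.
    have -> : (n%:R + 96)%:E = (97%:E + (\sum_(j < n | j != i) 1%:E))%E :> \bar R.
      rewrite sumEFin -EFinD sumr_const; congr (_%:E).
      have -> : #|[pred j : 'I_n | j != i]| = n.-1.
        by rewrite cardC1 card_ord.
      case: n i {mS S0 mean E} => [[]//|m] _.
      by rewrite -natr1/=; lra.
    rewrite leeD ?expectation_abs_sqr_le//; apply: lee_sum => j ji.
    by rewrite expectation_abs_mul// eq_sym.
  apply: le_trans (lee_sum _ (fun i _ => row i)) _.
  by rewrite sumEFin sumr_const card_ord mulr_natl.
set Z := (\int[P]_w _)%E.
(* The expansion of the square is stated with sums only, so that no extended real is subtracted. *)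
have : (Z + (2 * n%:R * n%:R)%:E = \int[P]_w (abs_arrival X n w ^+ 2)%:E + (n%:R ^+ 2)%:E)%E.
  transitivity (\int[P]_w (((abs_arrival X n w - n%:R) ^+ 2)%:E +
      (2 * n%:R)%:E * (abs_arrival X n w)%:E))%E.
    rewrite ge0_integralD//; last 4 first.
    - by move=> w _; rewrite lee_fin sqr_ge0.
    - apply/measurable_EFinP; apply: measurable_funX; exact: measurable_funB.
    - by move=> w _; rewrite -EFinM lee_fin !mulr_ge0.
    - by apply/measurable_EFinP; exact: measurable_funM.
    rewrite ge0_integralZl//; last 2 first.
    - by apply/measurable_EFinP.
    - by move=> w _; rewrite lee_fin.
    by rewrite mean -EFinM.
  transitivity (\int[P]_w ((abs_arrival X n w ^+ 2)%:E + (n%:R ^+ 2)%:E))%E.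
    by apply: eq_integral => w _; rewrite -EFinM -!EFinD; congr (_%:E); ring.
  rewrite ge0_integralD//; last 2 first.
  - by move=> w _; rewrite lee_fin sqr_ge0.
  - by apply/measurable_EFinP; apply: measurable_funX.
  by rewrite integral_cst//= probability_setT mule1.
move=> ZE; rewrite -(@leeD2rE _ (2 * n%:R * n%:R)%:E)// ZE.
apply: le_trans (leeD2r _ sqr) _.
have : 0 <= n%:R :> R by [].
by rewrite -!EFinD lee_fin; nra.
Qed.

End SecondMoment.

(** * Idle slots of the best effort policy *)

#[local] Arguments beu_count : simpl never.

Section Slots.
Context {R : realType} {d0 : measure_display} {Omega : measurableType d0}.
Variables (d db : R) (X Y : nat -> Omega -> R) (w : Omega).
Local Notation p := (beu_period d db).
Local Notation cnt n := (beu_count d db X Y n w).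
Local Notation tx n := (beu_tx d db X Y n w).

Lemma beu_period_ge1 : 1 <= p.
Proof. by rewrite /beu_period le_max lexx. Qed.

Lemma beu_countS n : cnt n.+1 = (cnt n + tx n)%N.
Proof. by []. Qed.

Lemma beu_count_le n : (cnt n <= n)%N.
Proof. by elim: n => // n IH; rewrite beu_countS -addn1 leq_add// leq_b1. Qed.

Lemma beu_count_mono m n : (m <= n)%N -> (cnt m <= cnt n)%N.
Proof.
elim: n => [|n IH]; first by rewrite leqn0 => /eqP ->.
rewrite leq_eqVlt => /predU1P[->//|/IH mn].
by rewrite beu_countS (leq_trans mn)// leq_addr.
Qed.

Lemma beu_tx0 : tx 0.
Proof. by []. Qed.

Lemma beu_count_gt0 n : (0 < cnt n.+1)%N.
Proof. exact: (@beu_count_mono 1). Qed.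

Lemma beu_tx_inj m n : tx m -> tx n -> cnt m = cnt n -> m = n.
Proof.
move=> tm tn cmn; case: (ltngtP m n) => // /beu_count_mono.
  by rewrite beu_countS tm cmn addn1 ltnn.
by rewrite beu_countS tn -cmn addn1 ltnn.
Qed.

(** The set under the infimum is a singleton, because the count increases right after each
    transmitting slot. *)
Lemma beu_tE n : tx n -> beu_t d db X Y (cnt n) w = (n%:R * p)%:E.
Proof.
move=> tn; rewrite /beu_t; rewrite -[RHS]ereal_inf1; congr ereal_inf.
apply/seteqP; split => [_ [m /andP[tm /eqP cm] <-]|_ ->] /=.
  by rewrite (beu_tx_inj tm tn cm).
by exists n => //; rewrite tn eqxx.
Qed.

Lemma beu_t_cases i : beu_t d db X Y i w = +oo%E \/
  exists n, [/\ tx n, cnt n = i & beu_t d db X Y i w = (n%:R * p)%:E].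
Proof.
have [[n /andP[tn /eqP cn]]|nex] := pselect (exists n, tx n && (cnt n == i)).
  by right; exists n; split=> //; rewrite -cn beu_tE.
left; rewrite /beu_t -[RHS](@ereal_inf0 R); congr ereal_inf.
by apply/seteqP; split => // x [n tn _]; apply: nex; exists n.
Qed.

(** Age, in slots, of the last transmitting slot up to and including [n]. The value 0 at slot 0 is
    right because both initial packets are available there. *)
Fixpoint beu_idle (n : nat) : nat :=
  if n is m.+1 then if tx n then 0%N else (beu_idle m).+1 else 0%N.

Lemma beu_idle_eq0 n : (beu_idle n == 0%N) = tx n.
Proof. by case: n => [|n] //=; case: ifP. Qed.

Lemma beu_idle_le n : (beu_idle n <= n)%N.
Proof. by elim: n => //= n IH; case: ifP. Qed.

Lemma beu_idle_last n :
  tx (n - beu_idle n)%N /\ (cnt (n - beu_idle n)%N).+1 = cnt n.+1.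
Proof.
elim: n => [|n [IH1 IH2]]; first by rewrite sub0n beu_countS beu_tx0.
rewrite [beu_idle n.+1]/=; case: (boolP (tx n.+1)) => tn.
  by rewrite subn0; split=> //; rewrite (beu_countS n.+1) tn addn1.
by rewrite subSS; split=> //; rewrite beu_countS (negbTE tn) addn0.
Qed.

(** Bounds the idle run after update [c]; the sum covers whichever node causes the wait. *)
Definition gap_bound (c : nat) : R := `|X c w| + `|Y c w|.

Lemma gap_bound_ge0 c : 0 <= gap_bound c.
Proof. by rewrite addr_ge0. Qed.

(** The packet for update [c] arrived before slot [m] (or is the initial one), and that for update
    [c.+1] does not arrive before slot [n]. Hence [Z c w] spans [n - m] slots, each of length at
    least 1. *)
Lemma has_energy_gap (Z : nat -> Omega -> R) c m n : (m <= n)%N ->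
  has_energy Z c (m%:R * p) w -> ~~ has_energy Z c.+1 (n%:R * p) w ->
  (n - m)%:R <= `|Z c w|.
Proof.
move=> mn; rewrite /has_energy/= -leNgt => hm hn.
have p1 := beu_period_ge1.
have m0 : 0 <= m%:R * p by rewrite mulr_ge0// (le_trans _ p1).
have : (n - m)%:R * p <= Z c w.
  rewrite natrB// mulrBl; case: c hm hn => [_|c /= hm].
    by rewrite /arrival big_ord1; lra.
  by move: hm; rewrite /arrival [in X in _ -> X -> _]big_ord_recr/=; lra.
have : (n - m)%:R <= (n - m)%:R * p by rewrite ler_peMr.
have := ler_norm (Z c w); lra.
Qed.

(** [(cnt n.+1).-1] is the index of the last update sent up to slot [n]. If slot [n] is idle, one of
    the nodes still lacks the next packet. *)
Lemma beu_idle_gap n : (beu_idle n)%:R <= gap_bound (cnt n.+1).-1.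
Proof.
case: (posnP (beu_idle n)) => [->|D0]; first exact: gap_bound_ge0.
have [tl cl] := beu_idle_last n.
have ntx : ~~ tx n by rewrite -beu_idle_eq0 -lt0n.
have cn : cnt n = (cnt (n - beu_idle n)%N).+1 by rewrite cl beu_countS (negbTE ntx) addn0.
have le : (n - beu_idle n <= n)%N by exact: leq_subr.
have -> : beu_idle n = (n - (n - beu_idle n))%N by rewrite subKn// beu_idle_le.
rewrite -cl/=; move: ntx tl; rewrite /beu_tx cn negb_and => + /andP[hX hY].
case/orP => [/(has_energy_gap le hX)|/(has_energy_gap le hY)] h;
  by rewrite (le_trans h)// ?lerDl ?lerDr.
Qed.

(** In the run after update [j] each square is at most [gap_bound j ^+ 2], and the run has at most
    [gap_bound j] idle slots. *)
Lemma sum_beu_idle_sqr n :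
  \sum_(m < n) (beu_idle m)%:R ^+ 2 <= \sum_(j < n) gap_bound j ^+ 3.
Proof.
case: n => [|n]; first by rewrite !big_ord0.
have sub c : (c <= n.+1)%N -> \sum_(j < c) gap_bound j ^+ 3 <= \sum_(j < n.+1) gap_bound j ^+ 3.
  move=> cn; rewrite (big_ord_widen _ (fun j => gap_bound j ^+ 3) cn) big_mkcond/=.
  by apply: ler_sum => j _; case: ifP => // _; rewrite exprn_ge0// gap_bound_ge0.
apply: le_trans (sub (cnt n.+1) (beu_count_le _)).
have last_gap k : \sum_(j < (cnt k.+1).-1) gap_bound j ^+ 3 +
    (beu_idle k)%:R * gap_bound (cnt k.+1).-1 ^+ 2 <=
    \sum_(j < cnt k.+1) gap_bound j ^+ 3.
  move: (beu_idle_gap k) (beu_count_gt0 k); case: (cnt k.+1) => //= c h _.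
  by rewrite big_ord_recr/= lerD2l [leRHS]exprS ler_wpM2r// exprn_ge0// gap_bound_ge0.
(* Invariant: finished runs are charged their full cube, the current run only its length so far
   times the square; [last_gap] completes that charge when the run ends. *)
have key : \sum_(m < n.+1) (beu_idle m)%:R ^+ 2 <=
    \sum_(j < (cnt n.+1).-1) gap_bound j ^+ 3 +
    (beu_idle n)%:R * gap_bound (cnt n.+1).-1 ^+ 2.
  elim: n {sub} => [|n IH].
    by rewrite big_ord1 expr0n/= mul0r addr0 big_ord0.
  rewrite big_ord_recr/=; case: (boolP (tx n.+1)) => tn.
    rewrite expr0n/= mul0r !addr0 (beu_countS n.+1) tn addn1/=.
    exact: le_trans IH (last_gap n).
  have := beu_idle_gap n.+1.
  rewrite (beu_countS n.+1) (negbTE tn) addn0/= (negbTE tn) => h.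
  have : (beu_idle n).+1%:R ^+ 2 <= gap_bound (cnt n.+1).-1 ^+ 2.
    by rewrite lerXn2r// ?nnegrE ?ler0n ?gap_bound_ge0.
  move: IH; rewrite -[in X in _ -> _ -> X]natr1 mulrDl mul1r -natr1.
  lra.
exact: le_trans key (last_gap n).
Qed.

Lemma beu_missesE n : (\sum_(m < n) (0 < beu_idle m) = n - cnt n)%N.
Proof.
elim: n => [|n IH]; first by rewrite big_ord0.
rewrite big_ord_recr/= IH beu_countS lt0n beu_idle_eq0.
have := beu_count_le n; case: (tx n) => /=; lia.
Qed.

(** Truncation at level [K]: a positive idle length [D] satisfies [D <= K] or [D <= K^-1 * D ^+ 2].
    The first term counts idle slots, the second is controlled by the cubes. *)
Lemma sum_beu_idle_le (K : R) n : 0 < K ->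
  \sum_(m < n) (beu_idle m)%:R <=
  K * (n - cnt n)%:R + K^-1 * \sum_(j < n) gap_bound j ^+ 3.
Proof.
move=> K0; have Ki : 0 < K^-1 by rewrite invr_gt0.
apply: (@le_trans _ _ (K * (n - cnt n)%:R + K^-1 * \sum_(m < n) (beu_idle m)%:R ^+ 2)); last first.
  by rewrite lerD2l ler_wpM2l ?(ltW Ki)// sum_beu_idle_sqr.
rewrite -beu_missesE natr_sum !mulr_sumr -big_split/=; apply: ler_sum => m _.
case: posnP => [->|D0]; first by rewrite expr0n/= !mulr0 addr0.
rewrite mulr1; set D := (_%:R : R).
have KK : K^-1 * K = 1 by rewrite mulVf// gt_eqF.
have [DK|/ltW KD] := leP D K.
  by rewrite (le_trans DK)// lerDl mulr_ge0 ?sqr_ge0// ltW.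
have : 1 <= K^-1 * D by rewrite -KK ler_wpM2l// ltW.
have : 0 <= D by rewrite ler0n.
rewrite expr2 mulrA; nra.
Qed.

(** Take the last idle slot [m] before [n] and the count [c] there: some node has not received its
    [c]-th harvest before time [m * p >= m], while [m.+1 - c] slots have been missed. Later slots
    transmit and leave this number unchanged. *)
Lemma beu_misses_le n : (0 < n - cnt n)%N ->
  exists2 c, (c <= n)%N & (n - cnt n)%:R <= 1 + \sum_(j < c) `|X j w| - c%:R
                       \/ (n - cnt n)%:R <= 1 + \sum_(j < c) `|Y j w| - c%:R.
Proof.
elim: n => // n IH; rewrite beu_countS.
have cn := beu_count_le n.
case: (boolP (tx n)) => tn.
  rewrite addn1 subSS => /IH[c cl h]; exists c => //; exact: leqW.
rewrite addn0 => _; exists (cnt n); first exact: leqW.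
have h (Z : nat -> Omega -> R) : ~~ has_energy Z (cnt n) (n%:R * p) w ->
    (n.+1 - cnt n)%:R <= 1 + \sum_(j < cnt n) `|Z j w| - (cnt n)%:R.
  rewrite /has_energy; case: (cnt n) (cn) => [|c] //= cn'; rewrite -leNgt => le.
  rewrite natrB ?leqW// lerD2r -natr1 addrC lerD2l.
  apply: (@le_trans _ _ (n%:R * p)); first by rewrite ler_peMr// beu_period_ge1.
  by apply: le_trans le _; apply: ler_sum => j _; exact: ler_norm.
by move: tn; rewrite /beu_tx negb_and => /orP[/h|/h]; [left|right].
Qed.

End Slots.

(** * Area under the age *)

Section Causality.
Context {R : realType} {d0 : measure_display} {Omega : measurableType d0}.
Variables (d db : R) (t tb : nat -> Omega -> \bar R) (w : Omega).
Hypotheses (d_gt0 : 0 < d) (db_gt0 : 0 < db).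
Hypothesis t0_ge0 : (0 <= t 0%N w)%E.
Hypothesis data_causal : forall i, (t i w + d%:E <= tb i w)%E.
Hypothesis half_duplex : forall i, (tb i w + db%:E <= t i.+1 w)%E.
Local Notation s := (d + db).

Lemma delivery_ge i : (t i w + s%:E <= tb i w + db%:E)%E.
Proof. by rewrite EFinD addeA leeD2r. Qed.

Lemma transmission_step i : (t i w + s%:E <= t i.+1 w)%E.
Proof. exact: le_trans (delivery_ge i) (half_duplex i). Qed.

Lemma transmission_ge i : ((i%:R * s)%:E <= t i w)%E.
Proof.
elim: i => [|i IH]; first by rewrite mul0r.
apply: le_trans (transmission_step i).
by rewrite -natr1 mulrDl mul1r EFinD leeD2r.
Qed.

Lemma transmission_mono i j : (i <= j)%N -> (t i w <= t j w)%E.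
Proof.
elim: j => [|j IH]; first by rewrite leqn0 => /eqP ->.
rewrite leq_eqVlt => /predU1P[->//|/IH h]; apply: le_trans h _.
apply: le_trans (transmission_step j).
by rewrite leeDl// lee_fin addr_ge0// ltW.
Qed.

Lemma delivered_fin i x : (tb i w + db%:E < x%:E)%E ->
  exists2 ti : R, t i w = ti%:E & 0 <= ti /\ ti + s < x.
Proof.
move=> ix; have := le_lt_trans (delivery_ge i) ix.
have : (0 <= t i w)%E.
  by apply: le_trans (transmission_ge i); rewrite lee_fin mulr_ge0// addr_ge0// ltW.
case: (t i w) => [ti| |]//=; rewrite ?lte_fin ?lee_fin => t0 tx.
by exists ti.
Qed.

Lemma latest_gen_le x (r : R) : 0 <= r ->
  (forall i ti, t i w = ti%:E -> 0 <= ti -> ti + s < x -> ti <= r) ->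
  (latest_gen db t tb x w <= r%:E)%E.
Proof.
move=> r0 h; apply: ge_ereal_sup => y [->|[i /= ix <-]]; first by rewrite lee_fin.
have [ti ti_eq [ti0 tix]] := delivered_fin ix.
by rewrite ti_eq lee_fin (h i).
Qed.

Lemma latest_gen_ge0 x : (0 <= latest_gen db t tb x w)%E.
Proof. by apply: ereal_sup_ubound; left. Qed.

Lemma age_ge x (r : R) : (latest_gen db t tb x w <= (x - r)%:E)%E ->
  (r%:E <= age db t tb x w)%E.
Proof.
rewrite /age; have := latest_gen_ge0 x.
case: (latest_gen db t tb x w) => [l| |]//=; rewrite !lee_fin; lra.
Qed.

Lemma age_ge0 x : 0 <= x -> (0 <= age db t tb x w)%E.
Proof.
move=> x0; apply: age_ge; rewrite subr0; apply: latest_gen_le => // i ti _ _.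
have := d_gt0; have := db_gt0; lra.
Qed.

Lemma area_ge0 T : (0 <= area db t tb T w)%E.
Proof.
by apply: integral_ge0 => x /=; rewrite in_itv/= => /andP[x0 _]; exact: age_ge0.
Qed.

(* Away from the windows of length p that follow the deliveries
   (and from [0, s + p]) the age is at least s + p; inside them the deficit
   integrates to p^2/2.  This is the tangent-line bound y^2/2 >= p y - p^2/2 on
   the gaps y between transmissions. *)
Lemma area_ge (p T : R) K : 0 < p -> 0 <= T -> (T%:E <= t K w)%E ->
  ((T * (s + p) - (K%:R * (p ^+ 2 / 2) + (s + p) ^+ 2 / 2))%:E <= area db t tb T w)%E.
Proof.
move=> p0 T0 TK; have s0 : 0 < s by rewrite addr_gt0.
(* Piece [j.+1] is the window of length [p] after the earliest delivery time of update [j]; piece 0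
   accounts for the zero initial age. When [t j w] is infinite, [fine] returns 0 and the spurious
   window only weakens the bound, at the same cost. *)
pose e i := if i is j.+1 then fine (t j w) + s + p else s + p.
pose b i := if i is j.+1 then fine (t j w) + s else 0.
pose r i := (e i - b i) ^+ 2 / 2.
have be i : b i <= e i by case: i => [|i] /=; have := s0; lra.
pose J i := `[b i, e i]%classic.
pose f i x := -1 * x + e i.
have mJ i : measurable (J i) by exact: measurable_itv.
have mf i : measurable_fun setT (f i) by apply: measurable_funD => //; exact: measurable_funM.
have f0 i x : J i x -> 0 <= f i x.
  by rewrite /J/= in_itv/= /f => /andP[_]; lra.
have fr i : (\int[lebesgue_measure]_(x in J i) (f i x)%:E <= (r i)%:E)%E.
  by rewrite /J /f integral_affine// lee_fin /r; lra.
pose G := sum_pieces J f K.+1.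
have GE : \sum_(i < K.+1) r i = K%:R * (p ^+ 2 / 2) + (s + p) ^+ 2 / 2.
  rewrite big_ord_recl addrC /r/= subr0; congr (_ + _).
  under eq_bigr do rewrite (addrC _ p) addrK.
  by rewrite sumr_const card_ord mulr_natl.
apply: (@le_trans _ _ (\int[lebesgue_measure]_(x in `[0%R, T]) (s + p - G x)%:E)%E).
  rewrite (mulrC T); apply: integral_cst_sub_ge => //.
  - by rewrite /= lebesgue_measure_itv/= lte_fin oppr0 addr0; case: ltP => // ?; congr (_%:E); lra.
  - by apply: measurable_funTS; exact: measurable_sum_pieces.
  - by move=> x; exact: sum_pieces_ge0.
  - by rewrite -GE; exact: integral_sum_pieces_le.
apply: le_integral_pointwise => x /=; rewrite in_itv/= => /andP[x0 xT].
have Ge i : (i < K.+1)%N -> b i <= x -> e i - x <= G x.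
  move=> iK bx; have [xe|/ltW ex] := leP x (e i).
    have -> : e i - x = f i x by rewrite /f; lra.
    by apply: le_sum_pieces => //; rewrite /J/= in_itv/= bx xe.
  by apply: (@le_trans _ _ 0); [lra|exact: sum_pieces_ge0].
(* It remains to see that each generation time [ti] delivered before [x] satisfies
   [ti + s + p - x <= G x], which is [Ge] at its window. *)
apply: age_ge; apply: latest_gen_le.
  by have := Ge 0%N isT x0; rewrite /e; lra.
move=> i ti tiE ti0 tix.
have iK : (i < K)%N.
  rewrite ltnNge; apply/negP => /transmission_mono/(le_trans TK).
  by rewrite tiE lee_fin; lra.
have := Ge i.+1 iK; rewrite /b /e tiE/= => /(_ (ltW tix)); lra.
Qed.

End Causality.

(** * Area under the age for the best effort policy *)

Section BeuArea.
Context {R : realType} {d0 : measure_display} {Omega : measurableType d0}.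
Variables (d db : R) (X Y : nat -> Omega -> R) (w : Omega).
Hypotheses (d_gt0 : 0 < d) (db_gt0 : 0 < db).
Local Notation p := (beu_period d db).
Local Notation s := (d + db).
Local Notation t := (beu_t d db X Y).
Local Notation tb := (beu_tb d db X Y).

Lemma beu_period_ge : s <= p.
Proof. by rewrite /beu_period le_max lexx orbT. Qed.

(** The last update sent up to slot [m] was generated at [(m - beu_idle m) * p] and is delivered no
    later than [m * p + s], hence before [x]. *)
Lemma beu_age_le x (m : nat) : m%:R * p + s < x ->
  (age db t tb x w <= (x - m%:R * p + p * (beu_idle d db X Y w m)%:R)%:E)%E.
Proof.
move=> mx; set D := beu_idle d db X Y w m.
have [tl _] := beu_idle_last d db X Y w m; rewrite -/D in tl.
have Dm : (D <= m)%N := beu_idle_le d db X Y w m.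
have p1 := beu_period_ge1 d db.
have : (((m - D)%:R * p)%:E <= latest_gen db t tb x w)%E.
  rewrite -(beu_tE tl); apply: ereal_sup_ubound; right.
  exists (beu_count d db X Y (m - D) w) => //=.
  rewrite /beu_tb (beu_tE tl) -!EFinD lte_fin.
  apply: le_lt_trans mx; rewrite -addrA lerD2r natrB// ler_wpM2r// ?(le_trans _ p1)//.
  by rewrite gerBl.
rewrite /age natrB//; case: (latest_gen _ _ _ _ _) => [l| |]//=; rewrite ?leNye// !lee_fin.
nra.
Qed.

(** The interval is cut at the times [m * p + s]. Without idle slots each window is a trapezoid of
    area [p * (s + p / 2)]; the idle length at slot [m] raises the age there by at most [p] times
    itself. *)
Lemma beu_area_le (T : R) n : T <= n%:R * p + s ->
  (area db t tb T w <=
   (s ^+ 2 / 2 + n%:R * (p * (s + p / 2)) +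
    p ^+ 2 * \sum_(m < n) (beu_idle d db X Y w m)%:R)%:E)%E.
Proof.
move=> Tn; have s0 : 0 < s by rewrite addr_gt0.
have p1 := beu_period_ge1 d db; have p0 : 0 < p by rewrite (lt_le_trans _ p1).
pose D m := p * (beu_idle d db X Y w m)%:R.
have D0 m : 0 <= D m by rewrite mulr_ge0// ltW.
pose J i := if i is m.+1 then `[m%:R * p + s, m.+1%:R * p + s]%classic else `[0, s]%classic.
pose v i := if i is m.+1 then - (m%:R * p) + D m else 0.
pose f i x := 1 * x + v i.
pose r i := if i is m.+1 then p * (s + p / 2) + p * D m else s ^+ 2 / 2.
have mJ i : measurable (J i) by case: i => [|i]; exact: measurable_itv.
have mf i : measurable_fun setT (f i) by apply: measurable_funD => //; exact: measurable_funM.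
have f0 i x : J i x -> 0 <= f i x.
  rewrite /f; case: i => [|m] /=; rewrite in_itv/= => /andP[h _]; first by lra.
  by have := D0 m; lra.
have fr i : (\int[lebesgue_measure]_(x in J i) (f i x)%:E <= (r i)%:E)%E.
  case: i => [|m]; rewrite /J /f integral_affine ?lee_fin /r/v.
  - lra.
  - exact: ltW.
  - by rewrite -natr1; lra.
  - by rewrite -natr1; lra.
pose G := sum_pieces J f n.+1.
have -> : s ^+ 2 / 2 + n%:R * (p * (s + p / 2)) +
    p ^+ 2 * \sum_(m < n) (beu_idle d db X Y w m)%:R = \sum_(i < n.+1) r i.
  rewrite big_ord_recl/= -addrA; congr (_ + _).
  rewrite big_split/= sumr_const card_ord mulr_natl; congr (_ + _).
  by rewrite mulr_sumr; apply: eq_bigr => m _; rewrite /D; ring.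
apply: (@le_trans _ _ (\int[lebesgue_measure]_(x in `[0%R, T]) (G x)%:E)%E); last first.
  exact: integral_sum_pieces_le.
apply: le_integral_pointwise => x /=; rewrite in_itv/= => /andP[x0 xT].
have Gf i : (i < n.+1)%N -> J i x -> (age db t tb x w <= (f i x)%:E)%E ->
    (age db t tb x w <= (G x)%:E)%E.
  by move=> ni Jx h; apply: le_trans h _; rewrite lee_fin; exact: le_sum_pieces.
have [xs|sx] := leP x s.
  apply: (Gf 0%N) => //; first by rewrite /J/= in_itv/= x0 xs.
  rewrite /age /f /v/= mul1r addr0; have := latest_gen_ge0 db t tb w x.
  by case: (latest_gen _ _ _ _ _) => [l| |]//=; rewrite ?leNye// !lee_fin; lra.
have [m [mn mx xm]] : exists m, [/\ (m < n)%N, m%:R * p + s < x & x <= m.+1%:R * p + s].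
  elim: n {G Gf Tn xT} (le_trans xT Tn) => [|n IH] xn; first by move: sx xn; rewrite mul0r; lra.
  have [xn'|nx] := leP x (n%:R * p + s).
    by have [m [mn ? ?]] := IH xn'; exists m; split=> //; exact: leqW.
  by exists n; split.
apply: (Gf m.+1) => //; first by rewrite /J/= in_itv/= (ltW mx) xm.
apply: le_trans (beu_age_le mx) _.
by rewrite lee_fin /f /v /D; lra.
Qed.

End BeuArea.

(** * Feasibility of the best effort policy *)

Section Feasibility.
Context {R : realType} {d0 : measure_display} {Omega : measurableType d0}.
Variables (d db : R) (X Y : nat -> Omega -> R).
Hypotheses (d_gt0 : 0 < d) (db_gt0 : 0 < db).
Hypothesis mX : forall k, measurable_fun setT (X k).
Hypothesis mY : forall k, measurable_fun setT (Y k).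
Local Notation p := (beu_period d db).
Local Notation cnt n w := (beu_count d db X Y n w).
Local Notation tx n w := (beu_tx d db X Y n w).

Lemma has_energyW (Z : nat -> Omega -> R) c x y w : x <= y ->
  has_energy Z c x w -> has_energy Z c y w.
Proof.
move=> xy; rewrite /has_energy; case: (c == 0%N) => //= h; exact: lt_le_trans xy.
Qed.

Lemma measurable_has_energy (Z : nat -> Omega -> R) c x :
  (forall k, measurable_fun setT (Z k)) -> measurable [set w | has_energy Z c x w].
Proof.
move=> mZ; rewrite /has_energy; case: (c == 0%N) => /=.
  by rewrite (_ : [set _ | _] = setT)//; apply/seteqP.
have mA : measurable_fun setT (arrival Z c.-1) by apply: measurable_sum => j; exact: mZ.
rewrite (_ : [set w | _] = setT `&` arrival Z c.-1 @^-1` `]-oo, x[).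
  exact: mA.
by rewrite setTI; apply/seteqP; split => w /=; rewrite in_itv.
Qed.

(** Once the count is fixed to [c], the packet index in the energy conditions no longer depends on
    [w], and measurability becomes visible. *)
Lemma beu_tx_countE n c : [set w | tx n w && (cnt n w == c)] =
  [set w | cnt n w = c] `&` ([set w | has_energy X c (n%:R * p) w]
                         `&` [set w | has_energy Y c (n%:R * p) w]).
Proof.
apply/seteqP; split => w /=.
  by move=> /andP[/andP[hX hY] /eqP cn]; rewrite cn in hX hY.
by move=> [cn [hX hY]]; rewrite /beu_tx cn hX hY eqxx.
Qed.

Lemma measurable_beu_count n c : measurable [set w | cnt n w = c].
Proof.
elim: n c => [|n IH] c.
  have [->|c0] := eqVneq c 0%N.
    by rewrite (_ : [set _ | _] = setT); [exact: measurableT|apply/seteqP].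
  rewrite (_ : [set _ | _] = set0)//; apply/seteqP; split => // w /=.
  by move=> /esym/eqP; rewrite (negbTE c0).
have mA k : measurable [set w | tx n w && (cnt n w == k)].
  rewrite beu_tx_countE; apply: measurableI => //.
  by apply: measurableI; exact: measurable_has_energy.
rewrite (_ : [set w | _] = ([set w | cnt n w = c] `\` [set w | tx n w && (cnt n w == c)])
    `|` (if c is k.+1 then [set w | tx n w && (cnt n w == k)] else set0)).
  apply: measurableU; first exact: measurableD.
  by case: c => [|k]; [exact: measurable0|exact: mA].
apply/seteqP; split => w /=; rewrite beu_countS; case: (boolP (tx n w)) => tn.
- by rewrite addn1 => <-; right; rewrite /= tn eqxx.
- by rewrite addn0 => ->; left.
- case=> [[-> ]|]; first by rewrite eqxx.
  by case: c => [//|k] /= /andP[_ /eqP ->]; rewrite addn1.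
- by rewrite addn0; case=> [[]//|]; case: c => [//|k] /=; rewrite (negbTE tn).
Qed.

Lemma measurable_beu_t i : measurable_fun setT (beu_t d db X Y i).
Proof.
(* [beu_t i] is a countable infimum of these measurable functions, which are infinite at slots that
   do not send update [i]. *)
pose g n w : \bar R := if tx n w && (cnt n w == i) then (n%:R * p)%:E else +oo%E.
have mg n : measurable_fun setT (g n).
  apply: measurable_fun_ifT => //.
  apply: (measurable_fun_bool true).
  rewrite setTI (_ : _ @^-1` _ = [set w | tx n w && (cnt n w == i)]); last first.
    by apply/seteqP; split.
  rewrite beu_tx_countE; apply: measurableI; first exact: measurable_beu_count.
  by apply: measurableI; exact: measurable_has_energy.
have := measurable_fun_einfs mg 0%N; apply: eq_measurable_fun => w _.
rewrite /einfs /beu_t; apply/eqP; rewrite eq_le; apply/andP; split.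
  apply: le_ereal_inf_tmp => _ [n tn <-]; apply: ereal_inf_lbound.
  by exists n => //; rewrite /g [X in if X then _ else _]tn.
apply: le_ereal_inf_tmp => _ [n _ <-]; rewrite /g; case: ifPn => tn; last exact: leey.
by apply: ereal_inf_lbound; exists n.
Qed.

Lemma beu_count_gtP i n w : (i < cnt n w)%N ->
  exists m, [/\ (m < n)%N, tx m w & cnt m w = i].
Proof.
elim: n => // n IH; rewrite beu_countS.
have [/IH[m [mn tm cm]] _|ni] := ltnP i (cnt n w); first by exists m; split=> //; exact: ltnW.
case: (boolP (tx n w)) => tn; last by rewrite addn0 ltnNge ni.
rewrite addn1 ltnS => ni'; exists n; split => //.
by apply/eqP; rewrite eqn_leq ni ni'.
Qed.

Lemma same_history_has_energy (Z : nat -> Omega -> R) x w w' c y :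
  (forall k, arrival Z k w <= x \/ arrival Z k w' <= x -> arrival Z k w = arrival Z k w') ->
  y <= x -> has_energy Z c y w = has_energy Z c y w'.
Proof.
move=> h yx; rewrite /has_energy; case: (c == 0%N) => //=.
have [a|a] := ltP (arrival Z c.-1 w) y.
  by rewrite -h ?a//; left; rewrite (le_trans (ltW a)).
apply/esym/negbTE; rewrite -leNgt leNgt; apply/negP => a'.
have e := h c.-1 (or_intror (le_trans (ltW a') yx)).
by move: a'; rewrite -e ltNge a.
Qed.

Lemma same_history_beu x w w' n : same_history X Y x w w' -> n%:R * p <= x ->
  cnt n w = cnt n w' /\ tx n w = tx n w'.
Proof.
move=> [hX hY]; have p0 : 0 <= p := le_trans ler01 (beu_period_ge1 d db).
elim: n => [|n IH] nx; first by [].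
have nx' : n%:R * p <= x by rewrite (le_trans _ nx)// ler_wpM2r// ler_nat.
have [c t] := IH nx'.
have c' : cnt n.+1 w = cnt n.+1 w' by rewrite !beu_countS c t.
split=> //; rewrite /beu_tx c'.
by rewrite (same_history_has_energy _ hX nx) (same_history_has_energy _ hY nx).
Qed.

Lemma beu_feasible :
  feasible_online_policy d db X Y (beu_t d db X Y) (beu_tb d db X Y).
Proof.
have p1 := beu_period_ge1 d db; have p0 : 0 <= p := le_trans ler01 p1.
have sp := beu_period_ge d db.
have online x w w' i : same_history X Y x w w' ->
    (beu_t d db X Y i w <= x%:E)%E -> beu_t d db X Y i w' = beu_t d db X Y i w.
  move=> h; have [->|[n [tn cn tE]]] := beu_t_cases d db X Y w i; first by [].
  rewrite tE lee_fin => /(same_history_beu h)[c t].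
  by rewrite -cn c beu_tE// -t.
split; first exact: measurable_beu_t.
split; first by move=> i; apply: emeasurable_funD => //; exact: measurable_beu_t.
split; first by move=> w; have := @beu_tE _ _ _ d db X Y w 0%N isT; rewrite mul0r => ->.
split; first by [].
split.
  move=> i w; have [->|[n [tn cn ->]]] := beu_t_cases d db X Y w i.+1; first exact: leey.
  have [|m [mn tm cm]] := @beu_count_gtP i n w; first by rewrite cn.
  rewrite /beu_tb -cm (beu_tE tm) -!EFinD lee_fin -addrA.
  (* Update [i] went out in an earlier slot [m]; as [s <= p], it is delivered by slot [m.+1]. *)
  apply: (@le_trans _ _ (m.+1%:R * p)); last by rewrite ler_wpM2r// ler_nat.
  by rewrite -natr1 mulrDl mul1r lerD2l.
split.
  move=> i w x; have [->//|[n [/andP[hX _] cn ->]]] := beu_t_cases d db X Y w i.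
  by move=> [<-]; rewrite -cn.
split.
  move=> i w x; rewrite /beu_tb.
  have [->//|[n [/andP[_ hY] cn ->]]] := beu_t_cases d db X Y w i.
  by move=> [<-]; rewrite -cn; apply: has_energyW hY; rewrite lerDl ltW.
move=> x w w' h i; split; first exact: online.
rewrite /beu_tb => tx; congr (_ + _)%E; apply: online (h) _.
by apply: le_trans tx; rewrite leeDl// lee_fin ltW.
Qed.

End Feasibility.

(** * Average age of the best effort policy *)

Section ExpectLe.
Context {R : realType} {d0 : measure_display} {Omega : measurableType d0}.
Variable P : probability Omega R.
Implicit Types (F G : Omega -> R).

(** Measurability and nonnegativity travel with the bound, so that bounds add and scale without side
    conditions. *)
Definition expect_le F (r : R) : Prop :=
  [/\ measurable_fun setT F, forall w, 0 <= F w & (\int[P]_w (F w)%:E <= r%:E)%E].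

Lemma expect_leD F G a b : expect_le F a -> expect_le G b ->
  expect_le (fun w => F w + G w) (a + b).
Proof.
move=> [mF F0 Fa] [mG G0 Gb]; split; first exact: measurable_funD.
  by move=> w; exact: addr_ge0.
under eq_integral do rewrite EFinD.
rewrite ge0_integralD ?EFinD ?leeD//; try by move=> w _; rewrite lee_fin.
- exact/measurable_EFinP.
- exact/measurable_EFinP.
Qed.

Lemma expect_leZ F a k : 0 <= k -> expect_le F a -> expect_le (fun w => k * F w) (k * a).
Proof.
move=> k0 [mF F0 Fa]; split; first exact: measurable_funM.
  by move=> w; exact: mulr_ge0.
under eq_integral do rewrite EFinM.
rewrite ge0_integralZl//; first by rewrite EFinM lee_wpmul2l// lee_fin.
- exact/measurable_EFinP.
- by move=> w _; rewrite lee_fin.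
Qed.

Lemma expect_le_sum n (F : nat -> Omega -> R) (r : nat -> R) :
  (forall i, expect_le (F i) (r i)) ->
  expect_le (fun w => \sum_(i < n) F i w) (\sum_(i < n) r i).
Proof.
move=> h; elim: n => [|n IH].
  under eq_fun do rewrite big_ord0; rewrite big_ord0.
  by split=> //; rewrite integral0.
under eq_fun do rewrite big_ord_recr; rewrite big_ord_recr; exact: expect_leD.
Qed.

Lemma expect_le_indic (A : set Omega) : measurable A -> P A = 0%E -> expect_le \1_A 0.
Proof.
move=> mA PA; split; first exact: measurable_indic.
  by move=> w; rewrite indicE ler0n.
by rewrite integral_indic//= setIT PA.
Qed.

End ExpectLe.

Section UpperBound.
Context {R : realType} {d0 : measure_display} {Omega : measurableType d0}.
Variables (P : probability Omega R) (d db : R) (X Y : nat -> Omega -> R).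
Hypotheses (d_gt0 : 0 < d) (db_gt0 : 0 < db).
Hypotheses (expX : pairwise_exponential P X) (expY : pairwise_exponential P Y).
Local Notation p := (beu_period d db).
Local Notation s := (d + db).

Definition grid_dev (Z : nat -> Omega -> R) (h i : nat) (w : Omega) : R :=
  (abs_arrival Z (i * h) w - (i * h)%:R) ^+ 2.

Lemma abs_arrival_mono (Z : nat -> Omega -> R) m n w : (m <= n)%N ->
  abs_arrival Z m w <= abs_arrival Z n w.
Proof.
move=> mn; rewrite /abs_arrival (big_ord_widen _ (fun j => `|Z j w|) mn) big_mkcond/=.
by apply: ler_sum => j _; case: ifP.
Qed.

(** A maximal inequality from second moments: rounding [c] up to a multiple of [h] costs at most [h]
    by monotonicity, [z <= h + z ^+ 2 / h] at the grid point, and the sum over the grid dominates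
    each term. *)
Lemma abs_arrival_grid_le (Z : nat -> Omega -> R) q h c w : (0 < h)%N -> (c <= q * h)%N ->
  abs_arrival Z c w - c%:R <= 2 * h%:R + h%:R^-1 * \sum_(i < q.+1) grid_dev Z h i w.
Proof.
move=> h0 cqh; pose i := ((c + h.-1) %/ h)%N.
have ci : (c <= i * h)%N.
  have := ltn_ceil (c + h.-1) h0; rewrite -/i; nia.
have ic : (i * h <= c + h)%N.
  have := leq_trunc_div (c + h.-1) h; rewrite -/i; lia.
have iq : (i < q.+1)%N.
  rewrite ltnS leqNgt; apply/negP => qi.
  have := leq_trunc_div (c + h.-1) h; rewrite -/i; nia.
have hR : 0 < h%:R :> R by rewrite ltr0n.
set z := abs_arrival Z (i * h) w - (i * h)%:R.
have le1 : abs_arrival Z c w - c%:R <= z + h%:R.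
  have := abs_arrival_mono Z w ci.
  have : (i * h)%:R <= c%:R + h%:R :> R by rewrite -natrD ler_nat.
  rewrite /z; lra.
have le2 : z <= h%:R + h%:R^-1 * z ^+ 2.
  have hh : h%:R^-1 * h%:R = 1 :> R by rewrite mulVf// gt_eqF.
  have [zh|/ltW hz] := leP z h%:R.
    by rewrite (le_trans zh)// lerDl mulr_ge0 ?sqr_ge0// invr_ge0 ltW.
  have : 1 <= h%:R^-1 * z by rewrite -[leLHS]hh ler_wpM2l// invr_ge0 ltW.
  rewrite expr2 mulrA; nra.
have : z ^+ 2 <= \sum_(i < q.+1) grid_dev Z h i w.
  rewrite (bigD1 (Ordinal iq))//= lerDl sumr_ge0// => j _; exact: sqr_ge0.
move=> /(ler_wpM2l (ltW (_ : 0 < h%:R^-1 :> R))); rewrite invr_gt0 => /(_ hR).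
lra.
Qed.

Lemma beu_misses_grid_le q h w : (0 < h)%N ->
  ((q * h)%N - beu_count d db X Y (q * h) w)%N%:R <=
  1 + 2 * h%:R + h%:R^-1 * \sum_(i < q.+1) (grid_dev X h i w + grid_dev Y h i w).
Proof.
move=> h0; have hR : 0 < h%:R :> R by rewrite ltr0n.
have hV : 0 <= h%:R^-1 :> R by rewrite invr_ge0 ltW.
have S0 (Z : nat -> Omega -> R) : 0 <= h%:R^-1 * \sum_(i < q.+1) grid_dev Z h i w.
  by rewrite mulr_ge0// sumr_ge0// => i _; exact: sqr_ge0.
rewrite big_split/= mulrDr.
have := S0 X; have := S0 Y.
case: (posnP (q * h - beu_count d db X Y (q * h) w)%N) => [->|/beu_misses_le[c cq h']].
  by move=> *; rewrite mulr0n; lra.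
have := abs_arrival_grid_le X w h0 cq; have := abs_arrival_grid_le Y w h0 cq.
rewrite /abs_arrival; case: h'; lra.
Qed.

Lemma beu_area_grid_le (K T : R) q h w : 0 < K -> (0 < h)%N -> T <= (q * h)%:R * p + s ->
  (area db (beu_t d db X Y) (beu_tb d db X Y) T w <=
   (s ^+ 2 / 2 + (q * h)%:R * (p * (s + p / 2)) + p ^+ 2 * K * (1 + 2 * h%:R) +
    (p ^+ 2 * K * h%:R^-1 * \sum_(i < q.+1) (grid_dev X h i w + grid_dev Y h i w) +
     4 * p ^+ 2 * K^-1 * \sum_(j < (q * h)%N) (`|X j w| ^+ 3 + `|Y j w| ^+ 3)))%:E)%E.
Proof.
move=> K0 h0 Tn; apply: le_trans (beu_area_le _ _ _ _ _ Tn) _ => //; rewrite lee_fin.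
have idle := sum_beu_idle_le d db X Y w (q * h) K0.
have miss := beu_misses_grid_le q w h0.
have cube : \sum_(j < (q * h)%N) gap_bound X Y w j ^+ 3 <=
    4 * \sum_(j < (q * h)%N) (`|X j w| ^+ 3 + `|Y j w| ^+ 3).
  rewrite mulr_sumr; apply: ler_sum => j _; rewrite /gap_bound.
  have := normr_ge0 (X j w); have := normr_ge0 (Y j w).
  set a := `|X j w|; set b := `|Y j w| => b0 a0.
  (* [4 * (a ^+ 3 + b ^+ 3) - (a + b) ^+ 3] is three times this product. *)
  have : 0 <= (a + b) * (a - b) ^+ 2 by rewrite mulr_ge0 ?sqr_ge0 ?addr_ge0.
  by rewrite !exprS expr0; lra.
have p2 : 0 <= p ^+ 2 by exact: sqr_ge0.
have KV : 0 <= K^-1 by rewrite invr_ge0 ltW.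
have h1 := ler_wpM2l (ltW K0) miss.
have h2 := ler_wpM2l KV cube.
have : \sum_(m < (q * h)%N) (beu_idle d db X Y w m)%:R <=
  K * (1 + 2 * h%:R + h%:R^-1 * \sum_(i < q.+1) (grid_dev X h i w + grid_dev Y h i w)) +
  K^-1 * (4 * \sum_(j < (q * h)%N) (`|X j w| ^+ 3 + `|Y j w| ^+ 3)) by lra.
move=> /(ler_wpM2l p2); lra.
Qed.

(** The [q.+1] grid variances are each at most of order [q.+1 * h]; the factor [h^-1] makes their
    contribution independent of [h]. Here 194 = 2 * 97 and 768 = 4 * 2 * 96. *)
Lemma expect_beu_area_le (K T : R) q h : 0 < K -> (0 < h)%N -> T <= (q * h)%:R * p + s ->
  (\int[P]_w area db (beu_t d db X Y) (beu_tb d db X Y) T w <=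
   (s ^+ 2 / 2 + (q * h)%:R * (p * (s + p / 2)) + p ^+ 2 * K * (1 + 2 * h%:R) +
    (194 * p ^+ 2 * K * q.+1%:R ^+ 2 + 768 * p ^+ 2 * K^-1 * (q * h)%:R))%:E)%E.
Proof.
move=> K0 h0 Tn; have hR : 0 < h%:R :> R by rewrite ltr0n.
have p0 : 0 <= p := le_trans ler01 (beu_period_ge1 d db).
have KV : 0 <= K^-1 by rewrite invr_ge0 ltW.
have s0 : 0 < s by rewrite addr_gt0.
have expdev (Z : nat -> Omega -> R) i : pairwise_exponential P Z ->
    expect_le P (grid_dev Z h i) (97 * (i * h)%:R).
  move=> hZ; have [mZ _ _] := hZ; split.
  - by apply: measurable_funX; apply: measurable_funB => //; exact: measurable_abs_arrival.
  - by move=> w; exact: sqr_ge0.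
  - exact: abs_arrival_variance_le.
have expcube (Z : nat -> Omega -> R) i : pairwise_exponential P Z ->
    expect_le P (fun w => `|Z i w| ^+ 3) 96.
  move=> hZ; have [mZ _ _] := hZ; split.
  - apply: measurable_funX; exact: measurableT_comp (@normr_measurable R setT) (mZ i).
  - by move=> w; rewrite exprn_ge0.
  - exact: expectation_abs_cube_le.
have k1 : 0 <= p ^+ 2 * K * h%:R^-1 by rewrite !mulr_ge0 ?invr_ge0// ltW.
have k2 : 0 <= 4 * p ^+ 2 * K^-1 by rewrite !mulr_ge0.
have [mH H0 HE] := expect_leD
  (expect_leZ k1 (expect_le_sum q.+1 (fun i => expect_leD (expdev _ i expX) (expdev _ i expY))))
  (expect_leZ k2 (expect_le_sum (q * h)
    (fun i => expect_leD (expcube _ i expX) (expcube _ i expY)))).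
apply: le_trans (le_integral_pointwise P (fun w _ => beu_area_grid_le w K0 h0 Tn)) _.
under eq_integral do rewrite EFinD.
have c0 : 0 <= s ^+ 2 / 2 + (q * h)%:R * (p * (s + p / 2)) + p ^+ 2 * K * (1 + 2 * h%:R).
  by rewrite !addr_ge0 ?mulr_ge0 ?addr_ge0 ?mulr_ge0 ?sqr_ge0// ltW.
rewrite ge0_integralD//; last 2 first.
- by move=> w _; rewrite lee_fin.
- exact/measurable_EFinP.
rewrite integral_cst//= probability_setT mule1 [X in (_ <= X)%E]EFinD leeD2l//.
apply: le_trans HE _; rewrite lee_fin.
rewrite sumr_const card_ord -(mulr_natl (96 + 96)) lerD//; last by lra.
have : \sum_(i < q.+1) (97 * (i * h)%:R + 97 * (i * h)%:R) <= 194 * q.+1%:R ^+ 2 * h%:R :> R.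
  apply: (@le_trans _ _ (\sum_(i < q.+1) (194 * q.+1%:R * h%:R))).
    apply: ler_sum => i _; rewrite natrM.
    have : i%:R <= q.+1%:R :> R by rewrite ler_nat ltnW.
    by move=> /(ler_wpM2r (ltW hR)); lra.
  by rewrite sumr_const card_ord -(mulr_natl (_ * h%:R)); lra.
move=> /(ler_wpM2l k1) /le_trans; apply.
rewrite (_ : _ * (_ * h%:R) = p ^+ 2 * K * (194 * q.+1%:R ^+ 2) * (h%:R^-1 * h%:R)); last by ring.
by rewrite mulVf ?gt_eqF// mulr1; lra.
Qed.

Lemma beu_avg_age_le :
  (avg_age P db (beu_t d db X Y) (beu_tb d db X Y) <= (s + p / 2)%:E)%E.
Proof.
apply: limf_esup_le_eventually => e e0.
have p1 := beu_period_ge1 d db; have p0 : 0 < p := lt_le_trans ltr01 p1.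
have s0 : 0 < s by rewrite addr_gt0.
have [A A0 AE] : exists2 A : R, 0 < A & A = 768 by exists 768; rewrite ?ltr0n.
(* The parameters are fixed in the order [K], [q], [T], [h]. This [K] makes the cube term cost
   [e / 3] per unit time. *)
pose K := 3 * A * p / e; have K0 : 0 < K by rewrite divr_gt0 ?mulr_gt0.
have KV : 768 * p * K^-1 = e / 3.
  by rewrite -AE /K; field; rewrite !gt_eqF.
clearbody K; clear A A0 AE.
(* Since [h] is about [T / (p * q)], this [q] keeps [2 * p ^+ 2 * K * h] below [e / 3 * T] plus a
   constant. *)
pose q := (Num.truncn (6 * p * K / e)).+1.
have qK : 6 * p * K / e <= q%:R by rewrite ltW// truncnS_gt.
have q0 : 0 < q%:R :> R by rewrite ltr0n.
clearbody q.
(* Everything independent of [T]; it is absorbed in the last [e / 3 * T] once [T >= 3 * C / e]. *)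
pose C := p * q%:R * (s + p / 2 + e / 3) + s ^+ 2 / 2 + 3 * p ^+ 2 * K +
  194 * p ^+ 2 * K * q.+1%:R ^+ 2.
have C0 : 0 < C.
  have pK : 0 <= p ^+ 2 * K by rewrite mulr_ge0 ?sqr_ge0// ltW.
  have pKq : 0 <= p ^+ 2 * K * q.+1%:R ^+ 2 by rewrite mulr_ge0 ?sqr_ge0.
  have s2 : 0 <= s ^+ 2 := sqr_ge0 _.
  have : 0 < p * q%:R * (s + p / 2 + e / 3).
    by rewrite mulr_gt0 ?addr_gt0 ?divr_gt0 ?mulr_gt0.
  rewrite /C; lra.
exists (3 * C / e) => T hT.
have T0 : 0 < T by apply: lt_le_trans hT; rewrite divr_gt0// mulr_gt0.
pose x := T / (p * q%:R); have x0 : 0 <= x by rewrite divr_ge0 ?mulr_ge0// ltW.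
pose h := (Num.truncn x).+1.
have xh : x <= h%:R by rewrite ltW// truncnS_gt.
have hx : h%:R <= x + 1 by rewrite /h -natr1 lerD2r truncn_le.
have h0 : (0 < h)%N by [].
clearbody h.
have xT : x * (p * q%:R) = T by rewrite /x divfK// gt_eqF// mulr_gt0.
have Tn : T <= (q * h)%:R * p.
  rewrite natrM -xT; have := ler_wpM2l (ltW (mulr_gt0 p0 q0)) xh; lra.
have nT : (q * h)%:R * p <= T + p * q%:R.
  rewrite natrM -xT; have := ler_wpM2l (ltW (mulr_gt0 p0 q0)) hx; lra.
have Tn' : T <= (q * h)%:R * p + s by rewrite (le_trans Tn)// lerDl ltW.
rewrite lee_pdivrMl//; apply: le_trans (expect_beu_area_le K0 h0 Tn') _.
rewrite -EFinM lee_fin.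
have e1 : 2 * p ^+ 2 * K * h%:R <= e / 3 * T + 2 * p ^+ 2 * K.
  apply: (@le_trans _ _ (2 * p ^+ 2 * K * (x + 1))).
    by rewrite ler_wpM2l// ltW// !mulr_gt0.
  rewrite mulrDr mulr1 lerD2r -xT.
  have : 6 * p * K <= q%:R * e by rewrite -ler_pdivrMr.
  move=> /(ler_wpM2r (mulr_ge0 x0 (ltW p0))); lra.
have e2 : (q * h)%:R * (p * (s + p / 2)) + 768 * p ^+ 2 * K^-1 * (q * h)%:R <=
    (T + p * q%:R) * (s + p / 2 + e / 3).
  rewrite (_ : _ + _ = (q * h)%:R * p * (s + p / 2 + 768 * p * K^-1)); last by ring.
  by rewrite KV ler_wpM2r// !addr_ge0// ?divr_ge0// ltW.
have : C <= e / 3 * T.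
  by move: hT; rewrite ler_pdivrMr//; lra.
rewrite /C; lra.
Qed.

End UpperBound.

(** * Lower bound and optimality *)

Section LowerBound.
Context {R : realType} {d0 : measure_display} {Omega : measurableType d0}.
Variables (P : probability Omega R) (d db : R) (X Y : nat -> Omega -> R).
Variables (t tb : nat -> Omega -> \bar R).
Hypotheses (d_gt0 : 0 < d) (db_gt0 : 0 < db).
Hypothesis expX : pairwise_exponential P X.
Hypothesis feasible : feasible_online_policy d db X Y t tb.
Local Notation p := (beu_period d db).
Local Notation s := (d + db).

(* With K slightly larger than T / p, the K-th transmission occurs before T only
   if the K-th harvest is early (or an interarrival time is negative, a null
   event); the two subtracted sums exceed the main term on these events. *)
Lemma feasible_area_ge (eps T : R) K w : 0 < eps -> 0 < T -> (0 < K)%N ->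
  (1 + eps) * T <= K%:R * p ->
  ((T * (s + p) - (K%:R * (p ^+ 2 / 2) + (s + p) ^+ 2 / 2) -
    ((s + p) / (eps ^+ 2 * T) * (abs_arrival X K w - K%:R) ^+ 2 +
     (s + p) * T * \sum_(k < K) \1_[set u | X k u < 0] w))%:E <=
   area db t tb T w)%E.
Proof.
move=> e0 T0 K0 TK.
have [_ [_ [t0 [dc [hd [hX _]]]]]] := feasible.
have s0 : 0 < s by rewrite addr_gt0.
have p0 : 0 < p := lt_le_trans ltr01 (beu_period_ge1 d db).
have eT : 0 < eps ^+ 2 * T by rewrite mulr_gt0// exprn_gt0.
have k1 : 0 <= (s + p) / (eps ^+ 2 * T) by rewrite divr_ge0 ?addr_ge0 ?ltW.
have k2 : 0 <= (s + p) * T by rewrite mulr_ge0 ?addr_ge0 ?ltW.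
set D := (abs_arrival X K w - K%:R) ^+ 2.
set N := \sum_(k < K) _.
have D0 : 0 <= D by exact: sqr_ge0.
have N0 : 0 <= N by apply: sumr_ge0 => k _; rewrite indicE ler0n.
have kD := mulr_ge0 k1 D0; have kN := mulr_ge0 k2 N0.
have [TtK|tKT] := leP T%:E (t K w).
  apply: le_trans (area_ge d_gt0 db_gt0 (t0 w) (dc ^~ w) (hd ^~ w) p0 (ltW T0) TtK).
  by rewrite lee_fin; lra.
apply: le_trans (area_ge0 d_gt0 db_gt0 (t0 w) (dc ^~ w) (hd ^~ w) T).
rewrite lee_fin.
have rest : 0 <= K%:R * (p ^+ 2 / 2) + (s + p) ^+ 2 / 2.
  have : 0 <= K%:R * p ^+ 2 by rewrite mulr_ge0 ?sqr_ge0.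
  by have := sqr_ge0 (s + p); lra.
have sT := mulr_gt0 s0 T0; have pT := mulr_gt0 p0 T0.
have tK := transmission_ge (t0 w) (dc ^~ w) (hd ^~ w) K.
case tKE : (t K w) tKT tK => [x| |]//; rewrite lte_fin lee_fin => xT Kx.
(* If [s >= 1], the spacing of transmissions puts transmission [K] at or after
   [K * s = K * p >= (1 + eps) * T], which contradicts [x < T]. *)
have p_eq1 : p = 1.
  rewrite /beu_period; case: (leP 1 s) => // s1.
  have ps : p = s by rewrite /beu_period; apply/max_idPr.
  have : (1 + eps) * T <= x by rewrite (le_trans TK)// ps.
  by have := mulr_gt0 e0 T0; lra.
have aT : arrival X K.-1 w < T.
  by have := hX _ _ _ tKE; rewrite /has_energy gtn_eqF//= => /lt_trans; apply.
have [[k Xk]|noneg] := pselect (exists k : 'I_K, X k w < 0).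
  have N1 : 1 <= N.
    rewrite /N (bigD1 k)//= indicE mem_set// lerDl.
    by apply: sumr_ge0 => j _; rewrite indicE ler0n.
  have := ler_wpM2l k2 N1; lra.
have SE : abs_arrival X K w = arrival X K.-1 w.
  rewrite /arrival prednK//; apply: eq_bigr => k _.
  by rewrite ger0_norm// leNgt; apply/negP => Xk; apply: noneg; exists k.
(* The [K]-th harvest comes before [T] while [K >= (1 + eps) * T], so the deviation is at least
   [eps * T]; its coefficient turns the square into at least [(s + p) * T]. *)
have DT : eps ^+ 2 * T * T <= D.
  move: TK; rewrite p_eq1 mulr1 => TK.
  rewrite /D SE; set a := arrival X K.-1 w in aT *.
  have eT0 : 0 < eps * T by rewrite mulr_gt0.
  have le : eps * T <= K%:R - a by lra.
  have : 0 <= (K%:R - a - eps * T) * (K%:R - a + eps * T).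
    by rewrite mulr_ge0//; lra.
  by rewrite !expr2; lra.
have := ler_wpM2l k1 DT; rewrite [leLHS]mulrA divfK ?gt_eqF//; lra.
Qed.

(** The negative interarrival times have expected cost 0, and the deviation term is of order
    [K / T], which stays bounded when [K] is proportional to [T]. *)
Lemma expect_feasible_area_ge (eps T : R) K : 0 < eps -> 0 < T -> (0 < K)%N ->
  (1 + eps) * T <= K%:R * p ->
  ((T * (s + p) - (K%:R * (p ^+ 2 / 2) + (s + p) ^+ 2 / 2) -
    (s + p) / (eps ^+ 2 * T) * (97 * K%:R))%:E <= \int[P]_w area db t tb T w)%E.
Proof.
move=> e0 T0 K0 TK; have [mX _ _] := expX.
have s0 : 0 < s by rewrite addr_gt0.
have p0 : 0 < p := lt_le_trans ltr01 (beu_period_ge1 d db).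
have eT : 0 < eps ^+ 2 * T by rewrite mulr_gt0// exprn_gt0.
have k1 : 0 <= (s + p) / (eps ^+ 2 * T) by rewrite divr_ge0 ?addr_ge0 ?ltW.
have k2 : 0 <= (s + p) * T by rewrite mulr_ge0 ?addr_ge0 ?ltW.
have expdev : expect_le P (fun w => (abs_arrival X K w - K%:R) ^+ 2) (97 * K%:R).
  split; [|by move=> w; exact: sqr_ge0|exact: abs_arrival_variance_le].
  by apply: measurable_funX; apply: measurable_funB => //; exact: measurable_abs_arrival.
have expneg k : expect_le P \1_[set u | X k u < 0] 0.
  apply: expect_le_indic; last exact: exponential_lt0_null.
  rewrite (_ : [set _ | _] = setT `&` X k @^-1` `]-oo, 0[); first exact: mX.
  by rewrite setTI; apply/seteqP; split => w /=; rewrite in_itv.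
have [mH H0 HE] := expect_leD (expect_leZ k1 expdev) (expect_leZ k2 (expect_le_sum K expneg)).
apply: le_trans; last first.
  by apply: le_integral_pointwise => w _; exact: (feasible_area_ge w e0 T0 K0 TK).
apply: le_trans (integral_cst_sub_ge _ measurableT (probability_setT P) mH H0 HE).
by rewrite lee_fin big1// mulr0 addr0 mulr1.
Qed.

Lemma feasible_avg_age_ge : ((s + p / 2)%:E <= avg_age P db t tb)%E.
Proof.
apply: limf_esup_ge_eventually => e e0.
have p1 := beu_period_ge1 d db; have p0 : 0 < p := lt_le_trans ltr01 p1.
have s0 : 0 < s by rewrite addr_gt0.
have sp0 : 0 < s + p by rewrite addr_gt0.
(* With [K] about [(1 + eps) * T / p], the loss [K * p ^+ 2 / 2] exceeds [T * p / 2] by [e * T / 2]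
   plus a constant; the other half of [e] absorbs [C]. *)
have [eps eps0 epsE] : exists2 eps, 0 < eps & eps * p = e.
  by exists (e / p); rewrite ?divr_gt0 ?divfK ?gt_eqF.
pose c := (s + p) * 97 / eps ^+ 2.
have c0 : 0 < c by rewrite divr_gt0 ?exprn_gt0// mulr_gt0// ltr0n.
pose C := p ^+ 2 / 2 + (s + p) ^+ 2 / 2 + c * ((1 + eps) / p + 1).
have C0 : 0 < C.
  have : 0 < c * ((1 + eps) / p + 1) by rewrite mulr_gt0// addr_gt0// divr_gt0// addr_gt0.
  by rewrite /C; have := sqr_ge0 p; have := sqr_ge0 (s + p); lra.
exists (Num.max 1 (2 * C / e)) => T; rewrite ge_max => /andP[T1 TC].
have T0 : 0 < T := lt_le_trans ltr01 T1.
pose x := (1 + eps) * T / p; have x0 : 0 <= x.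
  by rewrite /x !mulr_ge0 ?addr_ge0 ?invr_ge0 ?ltW.
pose K := (Num.truncn x).+1.
have xK : x <= K%:R by rewrite ltW// truncnS_gt.
have Kx : K%:R <= x + 1 by rewrite /K -natr1 lerD2r truncn_le.
have xp : x * p = (1 + eps) * T by rewrite /x divfK// gt_eqF.
have TK : (1 + eps) * T <= K%:R * p by rewrite -xp ler_wpM2r// ltW.
have K0 : (0 < K)%N by [].
clearbody K.
rewrite lee_pdivlMl//; apply: le_trans (expect_feasible_area_ge eps0 T0 K0 TK).
rewrite -EFinM lee_fin.
have -> : (s + p) / (eps ^+ 2 * T) * (97 * K%:R) = c * (K%:R / T).
  by rewrite /c; field; rewrite !gt_eqF.
have e1 : c * (K%:R / T) <= c * ((1 + eps) / p + 1).
  apply: (ler_wpM2l (ltW c0)).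
  rewrite ler_pdivrMr// (le_trans Kx)// mulrDl mul1r.
  by rewrite lerD// /x mulrAC.
have e2 : K%:R * (p ^+ 2 / 2) <= T * p / 2 + e * T / 2 + p ^+ 2 / 2.
  have p2 : 0 <= p ^+ 2 / 2 by rewrite divr_ge0 ?sqr_ge0.
  apply: le_trans (ler_wpM2r p2 Kx) _.
  have -> : (x + 1) * (p ^+ 2 / 2) = (x * p) * p / 2 + p ^+ 2 / 2 by ring.
  by rewrite xp (_ : _ * T * p = T * p + eps * p * T); [rewrite epsE; lra|ring].
have : C <= e / 2 * T by move: TC; rewrite ler_pdivrMr//; lra.
rewrite /C; lra.
Qed.

End LowerBound.

Lemma optimal_ageE (R : realType) (d db : R) :
  Num.max (2^-1 + d + db) (3 / 2 * (d + db)) = d + db + beu_period d db / 2.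
Proof.
rewrite /beu_period; have [s1|s1] := leP 1 (d + db).
  by rewrite max_r; lra.
by rewrite max_l; lra.
Qed.

Theorem theorem4 (R : realType) (dO : measure_display) (Omega : measurableType dO)
    (P : probability Omega R) (X Y : nat -> Omega -> R) (d db : R) :
  0 < d -> 0 < db ->
  poisson_energy_arrivals P X Y ->
  let v := (Num.max (2^-1 + d + db) (3 / 2 * (d + db)))%:E in
  [/\ feasible_online_policy d db X Y (beu_t d db X Y) (beu_tb d db X Y),
      avg_age P db (beu_t d db X Y) (beu_tb d db X Y) = v
    & rho P d db X Y = v].
Proof.
move=> d_gt0 db_gt0 pXY; rewrite optimal_ageE => v.
have expX := poisson_pairwise_exponential pXY.
have expY := poisson_pairwise_exponential (poisson_energy_arrivalsC pXY).
have [mX _ _] := expX; have [mY _ _] := expY.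
have feas : feasible_online_policy d db X Y (beu_t d db X Y) (beu_tb d db X Y).
  exact: beu_feasible.
have avg : avg_age P db (beu_t d db X Y) (beu_tb d db X Y) = v.
  apply/eqP; rewrite eq_le beu_avg_age_le//=.
  (* The lower bound for arbitrary feasible policies also gives the missing inequality for the best
     effort policy itself. *)
  exact: (feasible_avg_age_ge d_gt0 db_gt0 expX feas).
split=> //; apply/eqP; rewrite eq_le; apply/andP; split.
  by apply: ereal_inf_lbound; exists (beu_t d db X Y), (beu_tb d db X Y).
apply: le_ereal_inf_tmp => _ [t [tb [ft ->]]].
exact: feasible_avg_age_ge ft.
Qed.
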